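(* Let $(\mathbb{C},\mathbb{A},\lambda)$ be an entwining structure in $\mathcal V$ and let $g:I\to C$ be a group-like element of $\mathbb{C}$. If $C$ is flat, then the following are equivalent: (i) The functor $$\bar F:\mathcal V_{A^{\mathbb C}}\to \mathcal V^{\mathbb C}_{\mathbb A}(\lambda),\qquad X\mapsto (X\otimes_{A^{\mathbb C}}A,\; X\otimes_{A^{\mathbb C}}m_A,\; X\otimes_{A^{\mathbb C}}g_A)$$ is an equivalence of categories. (ii) $A$ is $(\mathbb{C},g)$-Galois and ${}_{A^{\mathbb C}}A$ is faithfully flat.
   Context: $\mathcal V=(V,\otimes,I)$ is a strict monoidal category with equalizers and with coequalizers, and the tensor product preserves coequalizers in both variables. The name of an object also denotes its identity morphism. For an algebra (monoid) $B$ in $\mathcal V$, $\mathcal V_B$ is the category of right $B$-modules; $M\otimes_B N$ is the usual coequalizer. An entwining structure $(\mathbb C,\mathbb A,\lambda)$ consists of an algebra $\mathbb A=(A,e_A,m_A)$, a coalgebra (comonoid) $\mathbb C=(C,\varepsilon_C,\delta_C)$ in $\mathcal V$ and a morphism $\lambda:C\otimes A\to A\otimes C$ such that $\lambda(C\otimes e_A)=e_A\otimes C$, $(A\otimes\varepsilon_C)\lambda=\varepsilon_C\otimes A$, $(A\otimes\delta_C)\lambda=(\lambda\otimes C)(C\otimes\lambda)(\delta_C\otimes A)$ and $\lambda(C\otimes m_A)=(m_A\otimes C)(A\otimes\lambda)(\lambda\otimes A)$. $\mathcal V^{\mathbb C}_{\mathbb A}(\lambda)$ is the category of triples $(X,\xi_X,\nu_X)$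 with $(X,\xi_X:X\otimes A\to X)$ a right $A$-module, $(X,\nu_X:X\to X\otimes C)$ a right $C$-comodule and $\nu_X\xi_X=(\xi_X\otimes C)(X\otimes\lambda)(\nu_X\otimes A)$; morphisms are morphisms of $\mathcal V$ that are both $A$-module and $C$-comodule morphisms. A group-like element of $\mathbb C$ is a morphism $g:I\to C$ with $\varepsilon_C g=1_I$ and $\delta_C g=g\otimes g$. Put $g_A=\lambda(g\otimes A):A\to A\otimes C$; this makes $A$ a right $C$-comodule. Let $i_A:A^{\mathbb C}\to A$ be the equalizer of $g_A$ and $A\otimes g:A\to A\otimes C$; $A^{\mathbb C}$ carries an algebra structure making $i_A$ an algebra morphism, and $A$ is regarded as an $A^{\mathbb C}$-bimodule via $i_A$. Let $\mathrm{can}:A\otimes_{A^{\mathbb C}}A\to A\otimes C$ be the morphism induced on the quotient $A\otimes_{A^{\mathbb C}}A$ by $(m_A\otimes C)(A\otimes g_A):A\otimes A\to A\otimes C$. It is a morphism of $A$-corings from the canonical coring $A\otimes_{A^{\mathbb C}}A$ to the coring $A\otimes C$ determined by $\lambda$ (with counit $A\otimes\varepsilon_C$ and comultiplication $A\otimes\delta_C$). $A$ is called $(\mathbb C,g)$-Galois if $\mathrm{can}$ is an isomorphism (of $A$-corings; equivalently, an isomorphism in $\mathcal V$). Flatness: for algebras $R,S$ in $\mathcal V$ and an $R$-$S$-bimodule $M$, ${}_RM$ is flat if $-\otimes_R M:\mathcal V_R\to\mathcal V_S$ preserves equalizers, and faithfully flat if this functor is moreover conservative (reflects isomorphisms). ''$C$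 is flat'' means that $-\otimes C:\mathcal V\to\mathcal V$ preserves equalizers. ''${}_{A^{\mathbb C}}A$ is faithfully flat'' means that $-\otimes_{A^{\mathbb C}}A:\mathcal V_{A^{\mathbb C}}\to\mathcal V_A$ preserves equalizers and is conservative. *)

(* Defs.v *)
From Stdlib Require Import ssreflect IndefiniteDescription ProofIrrelevance.

Set Implicit Arguments.
Unset Strict Implicit.
Unset Printing Implicit Defensive.

Record Category := {
  Ob :> Type;
  Hom : Ob -> Ob -> Type;
  idm : forall X, Hom X X;
  comp : forall X Y Z, Hom Y Z -> Hom X Y -> Hom X Z;
  comp_idl : forall X Y (f : Hom X Y), comp (idm Y) f = f;
  comp_idr : forall X Y (f : Hom X Y), comp f (idm X) = f;
  comp_assoc : forall X Y Z W (h : Hom Z W) (g : Hom Y Z) (f : Hom X Y),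
    comp h (comp g f) = comp (comp h g) f
}.
Arguments Hom {_} _ _.
Arguments idm {_} _.
Arguments comp {_ _ _ _} _ _.

Notation "g ∘ f" := (comp g f) (at level 40, left associativity).

Definition is_iso {C : Category} {X Y : C} (f : Hom X Y) : Prop :=
  exists g : Hom Y X, g ∘ f = idm X /\ f ∘ g = idm Y.

Definition is_equalizer {C : Category} {E X Y : C}
    (f g : Hom X Y) (e : Hom E X) : Prop :=
  f ∘ e = g ∘ e /\
  forall (Z : C) (h : Hom Z X), f ∘ h = g ∘ h -> exists! u : Hom Z E, e ∘ u = h.

Definition is_coequalizer {C : Category} {X Y Q : C}
    (f g : Hom X Y) (q : Hom Y Q) : Prop :=
  q ∘ f = q ∘ g /\
  forall (Z : C) (h : Hom Y Z), h ∘ f = h ∘ g -> exists! u : Hom Q Z, u ∘ q = h.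

Record Functor (C D : Category) := {
  fobj :> C -> D;
  fmap : forall X Y : C, Hom X Y -> Hom (fobj X) (fobj Y);
  fmap_id : forall X : C, fmap (idm X) = idm (fobj X);
  fmap_comp : forall (X Y Z : C) (g : Hom Y Z) (f : Hom X Y),
    fmap (g ∘ f) = fmap g ∘ fmap f
}.
Arguments fmap {_ _} _ {_ _} _.

Definition functor_id (C : Category) : Functor C C :=
  {| fobj := fun X => X; fmap := fun X Y f => f;
     fmap_id := fun X => eq_refl; fmap_comp := fun X Y Z g f => eq_refl |}.

Definition functor_comp (C D E : Category) (G : Functor D E) (F : Functor C D) :
  Functor C E.
Proof.
refine {| fobj := fun X => G (F X); fmap := fun X Y f => fmap G (fmap F f) |}.
- by move=> X; rewrite !fmap_id.
- by move=> X Y Z g f; rewrite !fmap_comp.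
Defined.

Definition naturally_isomorphic (C D : Category) (F G : Functor C D) : Prop :=
  exists eta : forall X : C, Hom (F X) (G X),
    (forall X, is_iso (eta X)) /\
    (forall (X Y : C) (f : Hom X Y), eta Y ∘ fmap F f = fmap G f ∘ eta X).

Definition is_equivalence (C D : Category) (F : Functor C D) : Prop :=
  exists G : Functor D C,
    naturally_isomorphic (functor_comp G F) (functor_id C) /\
    naturally_isomorphic (functor_comp F G) (functor_id D).

Definition preserves_equalizers (C D : Category) (F : Functor C D) : Prop :=
  forall (E X Y : C) (f g : Hom X Y) (e : Hom E X),
    is_equalizer f g e -> is_equalizer (fmap F f) (fmap F g) (fmap F e).

Definition preserves_coequalizers (C D : Category) (F : Functor C D) : Prop :=
  forall (X Y Q : C) (f g : Hom X Y) (q : Hom Y Q),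
    is_coequalizer f g q -> is_coequalizer (fmap F f) (fmap F g) (fmap F q).

Definition conservative (C D : Category) (F : Functor C D) : Prop :=
  forall (X Y : C) (f : Hom X Y), is_iso (fmap F f) -> is_iso f.

(* The tensor product is strictly associative and unital: the constraints are
   equalities of objects.  As these equalities are not definitional, a morphism
   is moved along one of them by composing with [idto], the identity morphism
   transported along the equality. *)
Definition idto {C : Category} {X Y : C} (e : X = Y) : Hom X Y :=
  match e in _ = Z return Hom X Z with eq_refl => idm X end.

Record StrictMonoidalCategory := {
  smc_cat :> Category;
  unit_ob : smc_cat;
  tens : smc_cat -> smc_cat -> smc_cat;
  htens : forall X Y X' Y' : smc_cat,
    Hom X X' -> Hom Y Y' -> Hom (tens X Y) (tens X' Y');
  htens_id : forall X Y : smc_cat, htens (idm X) (idm Y) = idm (tens X Y);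
  htens_comp : forall (X Y X' Y' X'' Y'' : smc_cat)
      (f' : Hom X' X'') (g' : Hom Y' Y'') (f : Hom X X') (g : Hom Y Y'),
    htens (f' ∘ f) (g' ∘ g) = htens f' g' ∘ htens f g;
  tens_assoc : forall X Y Z, tens (tens X Y) Z = tens X (tens Y Z);
  tens_unitl : forall X, tens unit_ob X = X;
  tens_unitr : forall X, tens X unit_ob = X;
  htens_assoc : forall (X Y Z X' Y' Z' : smc_cat)
      (f : Hom X X') (g : Hom Y Y') (h : Hom Z Z'),
    idto (tens_assoc X' Y' Z') ∘ htens (htens f g) h =
    htens f (htens g h) ∘ idto (tens_assoc X Y Z);
  htens_unitl : forall (X Y : smc_cat) (f : Hom X Y),
    idto (tens_unitl Y) ∘ htens (idm unit_ob) f = f ∘ idto (tens_unitl X);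
  htens_unitr : forall (X Y : smc_cat) (f : Hom X Y),
    idto (tens_unitr Y) ∘ htens f (idm unit_ob) = f ∘ idto (tens_unitr X)
}.
Arguments unit_ob {_}.
Arguments tens {_} _ _.
Arguments htens {_ _ _ _ _} _ _.

Notation "X ⊗ Y" := (tens X Y) (at level 35, right associativity).
Notation "f ⊠ g" := (htens f g) (at level 35, right associativity).

(* The identities [(X ⊗ Y) ⊗ Z = X ⊗ (Y ⊗ Z)], [unit_ob ⊗ X = X] and
   [X ⊗ unit_ob = X], as morphisms in both directions. *)
Notation assr X Y Z := (idto (tens_assoc X Y Z)).
Notation assl X Y Z := (idto (eq_sym (tens_assoc X Y Z))).
Notation unl X := (idto (tens_unitl X)).
Notation unl' X := (idto (eq_sym (tens_unitl X))).
Notation unr X := (idto (tens_unitr X)).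
Notation unr' X := (idto (eq_sym (tens_unitr X))).

Definition tensr (V : StrictMonoidalCategory) (Z : V) : Functor V V.
Proof.
refine {| fobj := (fun X => X ⊗ Z) : V -> V; fmap := fun X Y f => f ⊠ idm Z |}.
- by move=> X; rewrite htens_id.
- by move=> X Y W g f; rewrite -htens_comp comp_idl.
Defined.

Definition tensl (V : StrictMonoidalCategory) (Z : V) : Functor V V.
Proof.
refine {| fobj := (fun X => Z ⊗ X) : V -> V; fmap := fun X Y f => idm Z ⊠ f |}.
- by move=> X; rewrite htens_id.
- by move=> X Y W g f; rewrite -htens_comp comp_idl.
Defined.

Record BaseCategory := {
  base_smc :> StrictMonoidalCategory;
  has_equalizers : forall (X Y : base_smc) (f g : Hom X Y),
    exists (E : base_smc) (e : Hom E X), is_equalizer f g e;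
  has_coequalizers : forall (X Y : base_smc) (f g : Hom X Y),
    exists (Q : base_smc) (q : Hom Y Q), is_coequalizer f g q;
  tensr_coequalizers : forall Z : base_smc, preserves_coequalizers (tensr Z);
  tensl_coequalizers : forall Z : base_smc, preserves_coequalizers (tensl Z)
}.

Section CategoryFacts.
Context {C : Category}.

Lemma compl X Y Z W (g : @Hom C Y Z) (f : Hom X Y) h (E : g ∘ f = h)
  (k : Hom W X) : g ∘ (f ∘ k) = h ∘ k.
Proof. by rewrite comp_assoc E. Qed.

Lemma idto_irr (X Y : C) (e e' : X = Y) : idto e = idto e'.
Proof. by rewrite (proof_irrelevance _ e e'). Qed.

Lemma idto_id (X : C) (e : X = X) : idto e = idm X.
Proof. by rewrite (idto_irr e eq_refl). Qed.

Lemma idto_comp (X Y Z : C) (e : X = Y) (e' : Y = Z) :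
  idto e' ∘ idto e = idto (eq_trans e e').
Proof. by case: _ / e'; rewrite /= comp_idl. Qed.

Lemma coequalizer_epi (X Y Q Z : C) (f g : Hom X Y) (q : Hom Y Q)
    (u v : Hom Q Z) : is_coequalizer f g q -> u ∘ q = v ∘ q -> u = v.
Proof.
move=> [Hq U] E.
have [|w [_ W]] := U Z (v ∘ q); first by rewrite -!comp_assoc Hq.
by rewrite -(W _ E) -(W v).
Qed.

Lemma equalizer_mono (E X Y Z : C) (f g : Hom X Y) (e : Hom E X)
    (u v : Hom Z E) : is_equalizer f g e -> e ∘ u = e ∘ v -> u = v.
Proof.
move=> [He U] Huv.
have [|w [_ W]] := U Z (e ∘ v); first by rewrite !comp_assoc He.
by rewrite -(W _ Huv) -(W v).
Qed.

Definition equalizer_lift (E X Y Z : C) (f g : Hom X Y) (e : Hom E X)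
    (He : is_equalizer f g e) (h : Hom Z X) (Hh : f ∘ h = g ∘ h) :
  {u : Hom Z E | e ∘ u = h}.
Proof.
apply: constructive_indefinite_description.
by case: (proj2 He _ _ Hh) => u [Hu _]; exists u.
Qed.

Definition coequalizer_lift (X Y Q Z : C) (f g : Hom X Y) (q : Hom Y Q)
    (Hq : is_coequalizer f g q) (h : Hom Y Z) (Hh : h ∘ f = h ∘ g) :
  {u : Hom Q Z | u ∘ q = h}.
Proof.
apply: constructive_indefinite_description.
by case: (proj2 Hq _ _ Hh) => u [Hu _]; exists u.
Qed.
End CategoryFacts.

Section MonoidalFacts.
Context {V : StrictMonoidalCategory}.

Lemma idto_tensl (X Y Z : V) (e : X = Y) :
  idto e ⊠ idm Z = idto (f_equal (fun T => T ⊗ Z) e).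
Proof. by case: _ / e; rewrite /= htens_id. Qed.

Lemma idto_tensr (X Y Z : V) (e : X = Y) :
  idm Z ⊠ idto e = idto (f_equal (fun T => Z ⊗ T) e).
Proof. by case: _ / e; rewrite /= htens_id. Qed.

Lemma assrK (X Y Z : V) : assl X Y Z ∘ assr X Y Z = idm _.
Proof. by rewrite idto_comp idto_id. Qed.

Lemma asslK (X Y Z : V) : assr X Y Z ∘ assl X Y Z = idm _.
Proof. by rewrite idto_comp idto_id. Qed.

Lemma unl'K (X : V) : unl X ∘ unl' X = idm _.
Proof. by rewrite idto_comp idto_id. Qed.

Lemma unlK (X : V) : unl' X ∘ unl X = idm _.
Proof. by rewrite idto_comp idto_id. Qed.

Lemma unr'K (X : V) : unr X ∘ unr' X = idm _.
Proof. by rewrite idto_comp idto_id. Qed.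

Lemma unrK (X : V) : unr' X ∘ unr X = idm _.
Proof. by rewrite idto_comp idto_id. Qed.

Lemma assl_nat (X Y Z X' Y' Z' : V)
    (f : Hom X X') (g : Hom Y Y') (h : Hom Z Z') :
  assl X' Y' Z' ∘ (f ⊠ (g ⊠ h)) = ((f ⊠ g) ⊠ h) ∘ assl X Y Z.
Proof.
rewrite -[X in _ ∘ X]comp_idr -(asslK X Y Z) (comp_assoc _ (assr X Y Z)).
by rewrite -htens_assoc !comp_assoc assrK comp_idl.
Qed.

Lemma unl'_nat (X Y : V) (f : Hom X Y) :
  unl' Y ∘ f = (idm unit_ob ⊠ f) ∘ unl' X.
Proof.
rewrite -{1}[f]comp_idr -(unl'K X) (comp_assoc f) -htens_unitl.
by rewrite !comp_assoc unlK comp_idl.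
Qed.

Lemma unr'_nat (X Y : V) (f : Hom X Y) :
  unr' Y ∘ f = (f ⊠ idm unit_ob) ∘ unr' X.
Proof.
rewrite -{1}[f]comp_idr -(unr'K X) (comp_assoc f) -htens_unitr.
by rewrite !comp_assoc unrK comp_idl.
Qed.

Lemma htens_lr (X Y X' Y' : V) (f : Hom X X') (g : Hom Y Y') :
  (f ⊠ idm Y') ∘ (idm X ⊠ g) = f ⊠ g.
Proof. by rewrite -htens_comp comp_idl comp_idr. Qed.

Lemma htens_rl (X Y X' Y' : V) (f : Hom X X') (g : Hom Y Y') :
  (idm X' ⊠ g) ∘ (f ⊠ idm Y) = f ⊠ g.
Proof. by rewrite -htens_comp comp_idl comp_idr. Qed.

Lemma tensl_comp (X Y Z W : V) (g : Hom Y Z) (f : Hom X Y) :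
  (g ⊠ idm W) ∘ (f ⊠ idm W) = (g ∘ f) ⊠ idm W.
Proof. by rewrite -htens_comp comp_idl. Qed.

Lemma tensr_comp (X Y Z W : V) (g : Hom Y Z) (f : Hom X Y) :
  (idm W ⊠ g) ∘ (idm W ⊠ f) = idm W ⊠ (g ∘ f).
Proof. by rewrite -htens_comp comp_idl. Qed.

Lemma assr_l (X X' Y Z : V) (f : Hom X X') :
  assr X' Y Z ∘ ((f ⊠ idm Y) ⊠ idm Z) = (f ⊠ idm (Y ⊗ Z)) ∘ assr X Y Z.
Proof. by rewrite htens_assoc htens_id. Qed.

Lemma assr_m (X Y Y' Z : V) (f : Hom Y Y') :
  assr X Y' Z ∘ ((idm X ⊠ f) ⊠ idm Z) = (idm X ⊠ (f ⊠ idm Z)) ∘ assr X Y Z.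
Proof. by rewrite htens_assoc. Qed.

Lemma assr_r (X Y Z Z' : V) (f : Hom Z Z') :
  assr X Y Z' ∘ (idm (X ⊗ Y) ⊠ f) = (idm X ⊠ (idm Y ⊠ f)) ∘ assr X Y Z.
Proof. by rewrite -htens_id htens_assoc. Qed.

Lemma assl_l (X X' Y Z : V) (f : Hom X X') :
  assl X' Y Z ∘ (f ⊠ idm (Y ⊗ Z)) = ((f ⊠ idm Y) ⊠ idm Z) ∘ assl X Y Z.
Proof. by rewrite -assl_nat htens_id. Qed.

Lemma assl_m (X Y Y' Z : V) (f : Hom Y Y') :
  assl X Y' Z ∘ (idm X ⊠ (f ⊠ idm Z)) = ((idm X ⊠ f) ⊠ idm Z) ∘ assl X Y Z.
Proof. by rewrite assl_nat. Qed.

Lemma assl_r (X Y Z Z' : V) (f : Hom Z Z') :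
  assl X Y Z' ∘ (idm X ⊠ (idm Y ⊠ f)) = (idm (X ⊗ Y) ⊠ f) ∘ assl X Y Z.
Proof. by rewrite assl_nat htens_id. Qed.
End MonoidalFacts.

(* Equates two composites of transported identities. *)
Ltac coh := rewrite ?idto_tensl ?idto_tensr ?idto_comp ?idto_tensl ?idto_tensr
  ?idto_comp ?comp_idl ?comp_idr; first
  [ apply: idto_irr | rewrite idto_id // | symmetry; rewrite idto_id // ].

Record Algebra (V : StrictMonoidalCategory) := {
  alg_ob :> V;
  alg_unit : Hom unit_ob alg_ob;
  alg_mul : Hom (alg_ob ⊗ alg_ob) alg_ob;
  alg_unitl : alg_mul ∘ (alg_unit ⊠ idm alg_ob) = unl alg_ob;
  alg_unitr : alg_mul ∘ (idm alg_ob ⊠ alg_unit) = unr alg_ob;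
  alg_assoc : alg_mul ∘ (alg_mul ⊠ idm alg_ob) =
    alg_mul ∘ (idm alg_ob ⊠ alg_mul) ∘ assr alg_ob alg_ob alg_ob
}.
Arguments alg_unit {_} _.
Arguments alg_mul {_} _.

Definition is_algebra_morphism (V : StrictMonoidalCategory) (A B : Algebra V)
    (f : Hom A B) : Prop :=
  f ∘ alg_unit A = alg_unit B /\ f ∘ alg_mul A = alg_mul B ∘ (f ⊠ f).

Record RightModule (V : StrictMonoidalCategory) (A : Algebra V) := {
  mod_ob :> V;
  mod_act : Hom (mod_ob ⊗ A) mod_ob;
  mod_unit : mod_act ∘ (idm mod_ob ⊠ alg_unit A) = unr mod_ob;
  mod_assoc : mod_act ∘ (mod_act ⊠ idm A) =
    mod_act ∘ (idm mod_ob ⊠ alg_mul A) ∘ assr mod_ob A A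
}.
Arguments mod_act {_ _} _.

Definition is_module_morphism (V : StrictMonoidalCategory) (A : Algebra V)
    (X Y : RightModule A) (f : Hom X Y) : Prop :=
  f ∘ mod_act X = mod_act Y ∘ (f ⊠ idm A).

Lemma sig_ext (T : Type) (P : T -> Prop) (x y : {t | P t}) :
  proj1_sig x = proj1_sig y -> x = y.
Proof. by case: x y => [x p] [y q] /= E; apply: subset_eq_compat. Qed.

Definition ModCat (V : StrictMonoidalCategory) (A : Algebra V) : Category.
Proof.
unshelve refine {|
  Ob := RightModule A;
  Hom := fun X Y => {f : Hom X Y | is_module_morphism (X := X) (Y := Y) f};
  idm := fun X => exist _ (idm (mod_ob X)) _;
  comp := fun X Y Z g f => exist _ (proj1_sig g ∘ proj1_sig f) _ |}.
- by rewrite /is_module_morphism htens_id comp_idl comp_idr.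
- rewrite /is_module_morphism -comp_assoc (proj2_sig f) comp_assoc.
  by rewrite (proj2_sig g) -comp_assoc tensl_comp.
- by move=> X Y f; apply: sig_ext; rewrite /= comp_idl.
- by move=> X Y f; apply: sig_ext; rewrite /= comp_idr.
- by move=> X Y Z W h g f; apply: sig_ext; rewrite /= comp_assoc.
Defined.

Record Bimodule (V : StrictMonoidalCategory) (R S : Algebra V) := {
  bim_mod :> RightModule S;
  bim_lact : Hom (R ⊗ bim_mod) bim_mod;
  bim_lunit : bim_lact ∘ (alg_unit R ⊠ idm bim_mod) = unl bim_mod;
  bim_lassoc : bim_lact ∘ (alg_mul R ⊠ idm bim_mod) =
    bim_lact ∘ (idm R ⊠ bim_lact) ∘ assr R R bim_mod;
  bim_compat : mod_act bim_mod ∘ (bim_lact ⊠ idm S) =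
    bim_lact ∘ (idm R ⊠ mod_act bim_mod) ∘ assr R bim_mod S
}.
Arguments bim_lact {_ _ _} _.

Section TensorOver.
Context {V : BaseCategory} {R S : Algebra V}.

Definition tens_over_pair1 (X : RightModule R) (M : Bimodule R S) :
    Hom ((X ⊗ R) ⊗ M) (X ⊗ M) :=
  mod_act X ⊠ idm (M : V).

Definition tens_over_pair2 (X : RightModule R) (M : Bimodule R S) :
    Hom ((X ⊗ R) ⊗ M) (X ⊗ M) :=
  (idm (X : V) ⊠ bim_lact M) ∘ assr X R M.

Definition tens_over_sig (X : RightModule R) (M : Bimodule R S) :
  {Q : V & {q : Hom (X ⊗ M) Q |
     is_coequalizer (tens_over_pair1 X M) (tens_over_pair2 X M) q}}.
Proof.
have H := has_coequalizers (tens_over_pair1 X M) (tens_over_pair2 X M).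
case: (constructive_indefinite_description _ H) => Q HQ.
by exists Q; apply: constructive_indefinite_description.
Qed.

Definition tens_over_ob (X : RightModule R) (M : Bimodule R S) : V :=
  projT1 (tens_over_sig X M).

Definition tens_over_quo (X : RightModule R) (M : Bimodule R S) :
    Hom (X ⊗ M) (tens_over_ob X M) :=
  proj1_sig (projT2 (tens_over_sig X M)).

Lemma tens_over_coequalizer (X : RightModule R) (M : Bimodule R S) :
  is_coequalizer (tens_over_pair1 X M) (tens_over_pair2 X M) (tens_over_quo X M).
Proof. exact: (proj2_sig (projT2 (tens_over_sig X M))). Qed.

Lemma tens_over_coequalizer_tens (X : RightModule R) (M : Bimodule R S) (Z : V) :
  is_coequalizer (tens_over_pair1 X M ⊠ idm Z) (tens_over_pair2 X M ⊠ idm Z)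
    (tens_over_quo X M ⊠ idm Z).
Proof. exact: (@tensr_coequalizers V Z _ _ _ _ _ _ (tens_over_coequalizer X M)). Qed.

Lemma tens_over_quoE (X : RightModule R) (M : Bimodule R S) :
  tens_over_quo X M ∘ (mod_act X ⊠ idm (M : V)) =
  tens_over_quo X M ∘ ((idm (X : V) ⊠ bim_lact M) ∘ assr X R M).
Proof. exact: (proj1 (tens_over_coequalizer X M)). Qed.

Lemma tens_over_act_subproof (X : RightModule R) (M : Bimodule R S) :
  let h := tens_over_quo X M ∘ (idm (X : V) ⊠ mod_act M) ∘ assr X M S in
  h ∘ (tens_over_pair1 X M ⊠ idm (S : V)) = h ∘ (tens_over_pair2 X M ⊠ idm (S : V)).
Proof.
rewrite /= /tens_over_pair1 /tens_over_pair2 -!tensl_comp -!comp_assoc.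
rewrite assr_l (compl (assr_m _ _ _)) -!comp_assoc.
rewrite (compl (tensr_comp _ _ _)) bim_compat.
rewrite (compl (htens_rl _ _)) -htens_lr -!comp_assoc.
rewrite (compl (tens_over_quoE _ _)) -!comp_assoc (compl (assr_r _ _ _)).
rewrite -!tensr_comp -!comp_assoc; do 3 congr (_ ∘ _).
coh.
Qed.

Definition tens_over_act (X : RightModule R) (M : Bimodule R S) :
    Hom (tens_over_ob X M ⊗ S) (tens_over_ob X M) :=
  proj1_sig (coequalizer_lift (tens_over_coequalizer_tens X M S)
               (tens_over_act_subproof X M)).

Lemma tens_over_actE (X : RightModule R) (M : Bimodule R S) :
  tens_over_act X M ∘ (tens_over_quo X M ⊠ idm (S : V)) =
  tens_over_quo X M ∘ (idm (X : V) ⊠ mod_act M) ∘ assr X M S.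
Proof. exact: (proj2_sig (coequalizer_lift _ _)). Qed.

Definition tens_over (X : RightModule R) (M : Bimodule R S) : RightModule S.
Proof.
refine {| mod_ob := tens_over_ob X M; mod_act := tens_over_act X M |}.
- have He := tens_over_coequalizer_tens X M unit_ob.
  apply: (coequalizer_epi He).
  rewrite -comp_assoc htens_rl -htens_lr comp_assoc tens_over_actE -!comp_assoc.
  rewrite assr_r (compl (tensr_comp _ _ _)) mod_unit htens_unitr.
  by congr (_ ∘ _); coh.
- have He := @tensr_coequalizers V S _ _ _ _ _ _ (tens_over_coequalizer_tens X M S).
  apply: (coequalizer_epi He); rewrite /= -!comp_assoc tensl_comp tens_over_actE.
  rewrite -!tensl_comp -!comp_assoc (compl (tens_over_actE _ _)) -!comp_assoc assr_l.
  rewrite (compl (assr_m _ _ _)) -!comp_assoc (compl (tensr_comp _ _ _)).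
  rewrite mod_assoc (compl (htens_rl _ _)) -(htens_lr (tens_over_quo X M)) -!comp_assoc.
  rewrite (compl (tens_over_actE _ _)) -!comp_assoc (compl (assr_r _ _ _)).
  rewrite -!tensr_comp -!comp_assoc; do 3 congr (_ ∘ _).
  coh.
Defined.

Lemma tens_over_map_subproof (X Y : RightModule R) (M : Bimodule R S)
    (f : @Hom (ModCat R) X Y) :
  let h := tens_over_quo Y M ∘ (proj1_sig f ⊠ idm (M : V)) in
  h ∘ tens_over_pair1 X M = h ∘ tens_over_pair2 X M.
Proof.
rewrite /= /tens_over_pair1 /tens_over_pair2 -!comp_assoc tensl_comp.
rewrite (proj2_sig f) -tensl_comp (compl (tens_over_quoE _ _)) -!comp_assoc.
by rewrite assr_l (compl (htens_rl _ _)) (compl (htens_lr _ _)).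
Qed.

Definition tens_over_map_ob (X Y : RightModule R) (M : Bimodule R S)
    (f : @Hom (ModCat R) X Y) : Hom (tens_over_ob X M) (tens_over_ob Y M) :=
  proj1_sig (coequalizer_lift (tens_over_coequalizer X M)
               (tens_over_map_subproof M f)).

Lemma tens_over_mapE (X Y : RightModule R) (M : Bimodule R S)
    (f : @Hom (ModCat R) X Y) :
  tens_over_map_ob M f ∘ tens_over_quo X M =
  tens_over_quo Y M ∘ (proj1_sig f ⊠ idm (M : V)).
Proof. exact: (proj2_sig (coequalizer_lift _ _)). Qed.

Lemma tens_over_map_morphism (X Y : RightModule R) (M : Bimodule R S)
    (f : @Hom (ModCat R) X Y) :
  is_module_morphism (X := tens_over X M) (Y := tens_over Y M)
    (tens_over_map_ob M f).
Proof.
apply: (coequalizer_epi (tens_over_coequalizer_tens X M S)).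
rewrite -!comp_assoc tensl_comp tens_over_mapE.
rewrite tens_over_actE -!comp_assoc (compl (tens_over_mapE _ _)).
rewrite -tensl_comp (compl (tens_over_actE _ _)) -!comp_assoc assr_l.
by rewrite (compl (htens_lr _ _)) (compl (htens_rl _ _)).
Qed.

Definition tens_over_functor (M : Bimodule R S) :
  Functor (ModCat R) (ModCat S).
Proof.
refine {| fobj := (fun X => tens_over X M) : ModCat R -> ModCat S;
  fmap := fun X Y f => exist _ (tens_over_map_ob M f) (tens_over_map_morphism M f) |}.
- move=> X; apply: sig_ext => /=.
  apply: (coequalizer_epi (tens_over_coequalizer X M)).
  by rewrite tens_over_mapE /= htens_id comp_idl comp_idr.
- move=> X Y Z g f; apply: sig_ext => /=.
  apply: (coequalizer_epi (tens_over_coequalizer X M)).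
  rewrite tens_over_mapE /= -comp_assoc tens_over_mapE comp_assoc tens_over_mapE.
  by rewrite -comp_assoc tensl_comp.
Defined.

Definition left_flat (M : Bimodule R S) : Prop :=
  preserves_equalizers (tens_over_functor M).

Definition left_faithfully_flat (M : Bimodule R S) : Prop :=
  left_flat M /\ conservative (tens_over_functor M).
End TensorOver.

Record Coalgebra (V : StrictMonoidalCategory) := {
  coalg_ob :> V;
  coalg_counit : Hom coalg_ob unit_ob;
  coalg_comul : Hom coalg_ob (coalg_ob ⊗ coalg_ob);
  coalg_counitl :
    unl coalg_ob ∘ (coalg_counit ⊠ idm coalg_ob) ∘ coalg_comul = idm coalg_ob;
  coalg_counitr :
    unr coalg_ob ∘ (idm coalg_ob ⊠ coalg_counit) ∘ coalg_comul = idm coalg_ob;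
  coalg_coassoc :
    assr coalg_ob coalg_ob coalg_ob ∘ (coalg_comul ⊠ idm coalg_ob) ∘ coalg_comul =
    (idm coalg_ob ⊠ coalg_comul) ∘ coalg_comul
}.
Arguments coalg_counit {_} _.
Arguments coalg_comul {_} _.

Definition flat_object (V : StrictMonoidalCategory) (C : V) : Prop :=
  preserves_equalizers (tensr C).

Record is_entwining (V : StrictMonoidalCategory) (C : Coalgebra V) (A : Algebra V)
    (lam : Hom (C ⊗ A) (A ⊗ C)) : Prop := {
  entw_unit :
    lam ∘ (idm (C : V) ⊠ alg_unit A) ∘ unr' C = (alg_unit A ⊠ idm (C : V)) ∘ unl' C;
  entw_counit :
    unr A ∘ (idm (A : V) ⊠ coalg_counit C) ∘ lam =
    unl A ∘ (coalg_counit C ⊠ idm (A : V));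
  entw_comul :
    (idm (A : V) ⊠ coalg_comul C) ∘ lam =
    assr A C C ∘ (lam ⊠ idm (C : V)) ∘ assl C A C ∘ (idm (C : V) ⊠ lam) ∘
      assr C C A ∘ (coalg_comul C ⊠ idm (A : V));
  entw_mul :
    lam ∘ (idm (C : V) ⊠ alg_mul A) =
    (alg_mul A ⊠ idm (C : V)) ∘ assl A A C ∘ (idm (A : V) ⊠ lam) ∘ assr A C A ∘
      (lam ⊠ idm (A : V)) ∘ assl C A A
}.

Record Entwining (V : StrictMonoidalCategory) := {
  entw_coalg : Coalgebra V;
  entw_alg : Algebra V;
  entw_map : Hom (entw_coalg ⊗ entw_alg) (entw_alg ⊗ entw_coalg);
  entw_axioms : is_entwining entw_map
}.
Arguments entw_coalg {_} _.
Arguments entw_alg {_} _.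
Arguments entw_map {_} _.

Record is_comodule (V : StrictMonoidalCategory) (C : Coalgebra V) (X : V)
    (nu : Hom X (X ⊗ C)) : Prop := {
  comod_counit : unr X ∘ (idm X ⊠ coalg_counit C) ∘ nu = idm X;
  comod_coassoc :
    assr X C C ∘ (nu ⊠ idm (C : V)) ∘ nu = (idm X ⊠ coalg_comul C) ∘ nu
}.

Record EntwinedModule (V : StrictMonoidalCategory) (E : Entwining V) := {
  emod_mod :> RightModule (entw_alg E);
  emod_coact : Hom emod_mod (emod_mod ⊗ entw_coalg E);
  emod_comodule : is_comodule emod_coact;
  emod_compat :
    emod_coact ∘ mod_act emod_mod =
    (mod_act emod_mod ⊠ idm (entw_coalg E : V)) ∘
      assl emod_mod (entw_alg E) (entw_coalg E) ∘
      (idm (emod_mod : V) ⊠ entw_map E) ∘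
      assr emod_mod (entw_coalg E) (entw_alg E) ∘
      (emod_coact ⊠ idm (entw_alg E : V))
}.
Arguments emod_coact {_ _} _.

Definition is_comodule_morphism (V : StrictMonoidalCategory) (C : Coalgebra V)
    (X Y : V) (nuX : Hom X (X ⊗ C)) (nuY : Hom Y (Y ⊗ C)) (f : Hom X Y) : Prop :=
  nuY ∘ f = (f ⊠ idm (C : V)) ∘ nuX.

Definition EntwinedCat (V : StrictMonoidalCategory) (E : Entwining V) : Category.
Proof.
unshelve refine {|
  Ob := EntwinedModule E;
  Hom := fun X Y => {f : Hom X Y |
    is_module_morphism (X := X) (Y := Y) f /\
    is_comodule_morphism (emod_coact X) (emod_coact Y) f};
  idm := fun X => exist _ (idm (mod_ob X)) _;
  comp := fun X Y Z g f => exist _ (proj1_sig g ∘ proj1_sig f) _ |}.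
- split; first by rewrite /is_module_morphism htens_id comp_idl comp_idr.
  by rewrite /is_comodule_morphism htens_id comp_idl comp_idr.
- case: f g => [f [Hf Kf]] [g [Hg Kg]]; split.
    by rewrite /is_module_morphism /= -comp_assoc Hf comp_assoc Hg -comp_assoc tensl_comp.
  by rewrite /is_comodule_morphism /= comp_assoc Kg -comp_assoc Kf comp_assoc tensl_comp.
- by move=> X Y f; apply: sig_ext; rewrite /= comp_idl.
- by move=> X Y f; apply: sig_ext; rewrite /= comp_idr.
- by move=> X Y Z W h g f; apply: sig_ext; rewrite /= comp_assoc.
Defined.

Definition is_grouplike (V : StrictMonoidalCategory) (C : Coalgebra V)
    (g : Hom unit_ob C) : Prop :=
  coalg_counit C ∘ g = idm unit_ob /\
  coalg_comul C ∘ g = (g ⊠ g) ∘ unl' unit_ob.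

Section Coinvariants.
Context {V : BaseCategory} {E : Entwining V}.
Notation A := (entw_alg E).
Notation C := (entw_coalg E).
Notation lam := (entw_map E).
Context (g : Hom unit_ob C).

(* [g_A = lam (g ⊗ A)] and [A ⊗ g], as morphisms [A -> A ⊗ C]. *)
Definition gcoact : Hom A (A ⊗ C) := lam ∘ (g ⊠ idm (A : V)) ∘ unl' A.
Definition gtriv : Hom A (A ⊗ C) := (idm (A : V) ⊠ g) ∘ unr' A.

Definition coinv_sig : {B : V & {i : Hom B A | is_equalizer gcoact gtriv i}}.
Proof.
case: (constructive_indefinite_description _ (has_equalizers gcoact gtriv)) => B HB.
by exists B; apply: constructive_indefinite_description.
Qed.

Definition coinv_ob : V := projT1 coinv_sig.
Definition coinv_incl : Hom coinv_ob A := proj1_sig (projT2 coinv_sig).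

Lemma coinv_equalizer : is_equalizer gcoact gtriv coinv_incl.
Proof. exact: (proj2_sig (projT2 coinv_sig)). Qed.

Lemma gcoact_mul :
  gcoact ∘ alg_mul A =
  (alg_mul A ⊠ idm (C : V)) ∘ assl A A C ∘ (idm (A : V) ⊠ lam) ∘ assr A C A ∘
    (gcoact ⊠ idm (A : V)).
Proof.
rewrite /gcoact -!comp_assoc unl'_nat (compl (htens_lr _ _)) -htens_rl.
rewrite (comp_assoc lam) (comp_assoc lam) (entw_mul (entw_axioms E)).
rewrite -!tensl_comp -!comp_assoc; do 5 congr (_ ∘ _).
rewrite -htens_id (compl (assl_nat _ _ _)) -!comp_assoc; congr (_ ∘ _); coh.
Qed.

Lemma coinv_inclE : gcoact ∘ coinv_incl = gtriv ∘ coinv_incl.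
Proof. exact: (proj1 coinv_equalizer). Qed.

Lemma gcoact_left :
  gcoact ∘ (alg_mul A ∘ (coinv_incl ⊠ idm (A : V))) =
  (alg_mul A ⊠ idm (C : V)) ∘ (assl A A C ∘ (coinv_incl ⊠ gcoact)).
Proof.
rewrite comp_assoc gcoact_mul -!comp_assoc tensl_comp coinv_inclE /gtriv.
rewrite -!tensl_comp -!comp_assoc (compl (assr_m _ _ _)) -!comp_assoc.
rewrite (compl (tensr_comp _ _ _)) -(htens_rl coinv_incl gcoact) /gcoact.
rewrite -(tensr_comp _ (lam ∘ _)) -!comp_assoc; do 3 congr (_ ∘ _).
rewrite !comp_assoc; congr (_ ∘ _); coh.
Qed.

Lemma coinv_unit_subproof : gcoact ∘ alg_unit A = gtriv ∘ alg_unit A.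
Proof.
rewrite /gcoact /gtriv -!comp_assoc unl'_nat unr'_nat (compl (htens_lr _ _)).
rewrite (compl (htens_rl _ _)) -(htens_rl g) -(htens_lr _ g) -!comp_assoc.
have U := entw_unit (entw_axioms E).
have -> : forall k : Hom unit_ob (C ⊗ unit_ob),
    lam ∘ ((idm (C : V) ⊠ alg_unit A) ∘ k) =
    (alg_unit A ⊠ idm (C : V)) ∘ (unl' C ∘ (unr C ∘ k)).
  by move=> k; rewrite !comp_assoc -U -(comp_assoc _ (unr' C)) unrK comp_idr.
rewrite (compl (htens_unitr _)) -comp_assoc (compl (unl'_nat _)) -!comp_assoc.
congr (_ ∘ (_ ∘ _)); coh.
Qed.

Lemma gtriv_nat (X : V) (f : Hom X A) : gtriv ∘ f = (f ⊠ g) ∘ unr' X.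
Proof. by rewrite /gtriv -comp_assoc unr'_nat comp_assoc htens_rl. Qed.

Lemma coinv_mul_subproof :
  gcoact ∘ (alg_mul A ∘ (coinv_incl ⊠ coinv_incl)) =
  gtriv ∘ (alg_mul A ∘ (coinv_incl ⊠ coinv_incl)).
Proof.
rewrite [in RHS]gtriv_nat -{1}(htens_lr coinv_incl) (comp_assoc (alg_mul A)).
rewrite comp_assoc gcoact_left.
rewrite -!comp_assoc -htens_comp comp_idr coinv_inclE.
rewrite gtriv_nat.
rewrite -{1}[coinv_incl]comp_idr htens_comp (compl (assl_nat _ _ _)) !comp_assoc.
rewrite -htens_comp comp_idl -comp_assoc; congr (_ ∘ _); coh.
Qed.

Definition coinv_unit : Hom unit_ob coinv_ob :=
  proj1_sig (equalizer_lift coinv_equalizer coinv_unit_subproof).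

Definition coinv_mul : Hom (coinv_ob ⊗ coinv_ob) coinv_ob :=
  proj1_sig (equalizer_lift coinv_equalizer coinv_mul_subproof).

Lemma coinv_unitE : coinv_incl ∘ coinv_unit = alg_unit A.
Proof. exact: (proj2_sig (equalizer_lift _ _)). Qed.

Lemma coinv_mulE :
  coinv_incl ∘ coinv_mul = alg_mul A ∘ (coinv_incl ⊠ coinv_incl).
Proof. exact: (proj2_sig (equalizer_lift _ _)). Qed.

(* [A^C] with the unique structure making [coinv_incl] an algebra morphism. *)
Definition coinv_alg : Algebra V.
Proof.
refine {| alg_ob := coinv_ob; alg_unit := coinv_unit; alg_mul := coinv_mul |};
  apply: (equalizer_mono coinv_equalizer).
- rewrite comp_assoc coinv_mulE -comp_assoc -htens_comp coinv_unitE comp_idr.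
  by rewrite -(htens_lr _ coinv_incl) comp_assoc alg_unitl htens_unitl.
- rewrite comp_assoc coinv_mulE -comp_assoc -htens_comp coinv_unitE comp_idr.
  by rewrite -(htens_rl coinv_incl) comp_assoc alg_unitr htens_unitr.
- rewrite !comp_assoc coinv_mulE -!comp_assoc -htens_comp coinv_mulE comp_idr.
  rewrite (comp_assoc (coinv_incl ⊠ coinv_incl)) -htens_comp coinv_mulE comp_idr.
  rewrite -{3}[coinv_incl]comp_idl htens_comp comp_assoc alg_assoc -!comp_assoc.
  by rewrite htens_assoc (comp_assoc (idm _ ⊠ _)) -htens_comp comp_idl.
Defined.

Lemma coinv_incl_morphism : is_algebra_morphism (A := coinv_alg) (B := A) coinv_incl.
Proof. by split; [exact: coinv_unitE | exact: coinv_mulE]. Qed.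

(* [A] as a right [A^C]-module via [coinv_incl]. *)
Definition coinv_rmod : RightModule coinv_alg.
Proof.
refine {| mod_ob := A : V;
  mod_act := (alg_mul A ∘ (idm (A : V) ⊠ coinv_incl)) : Hom (A ⊗ coinv_alg) A |}.
- by rewrite -comp_assoc tensr_comp coinv_unitE alg_unitr.
- rewrite /= -!comp_assoc (compl (tensr_comp _ _ _)) coinv_mulE -!tensr_comp.
  rewrite -!comp_assoc -htens_assoc htens_rl (comp_assoc (idm _ ⊠ _)).
  rewrite (comp_assoc (alg_mul A) (idm _ ⊠ _ ∘ _)) (comp_assoc (alg_mul A)) -alg_assoc.
  by rewrite -!comp_assoc -htens_comp comp_idl.
Defined.

(* [A] as an [A^C]-[A]-bimodule: left action via [coinv_incl], right action by
   multiplication. *)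
Definition coinv_bimod : Bimodule coinv_alg A.
Proof.
refine {| bim_mod := {| mod_ob := A : V; mod_act := alg_mul A;
                        mod_unit := alg_unitr A; mod_assoc := alg_assoc A |};
  bim_lact := (alg_mul A ∘ (coinv_incl ⊠ idm (A : V))) : Hom (coinv_alg ⊗ A) A |}.
- by rewrite /= -comp_assoc tensl_comp coinv_unitE alg_unitl.
- rewrite /= -!comp_assoc tensl_comp coinv_mulE (comp_assoc (coinv_incl ⊠ _)) htens_lr.
  rewrite -tensl_comp comp_assoc alg_assoc -!comp_assoc htens_assoc.
  by rewrite (comp_assoc (idm _ ⊠ _)) -htens_comp comp_idl.
- rewrite /= -!comp_assoc -tensl_comp comp_assoc alg_assoc -!comp_assoc assr_l.
  by rewrite (comp_assoc (idm _ ⊠ _)) htens_rl (comp_assoc (coinv_incl ⊠ _)) htens_lr.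
Defined.

Definition can_pre : Hom (A ⊗ A) (A ⊗ C) :=
  (alg_mul A ⊠ idm (C : V)) ∘ assl A A C ∘ (idm (A : V) ⊠ gcoact).

Lemma can_subproof :
  can_pre ∘ tens_over_pair1 coinv_rmod coinv_bimod =
  can_pre ∘ tens_over_pair2 coinv_rmod coinv_bimod.
Proof.
rewrite /can_pre /tens_over_pair1 /tens_over_pair2 /= -!comp_assoc htens_rl.
rewrite (compl (tensr_comp _ _ _)) gcoact_left -[gcoact in LHS]comp_idl htens_comp.
rewrite -?comp_assoc (compl (assl_l _ _ _)) -!comp_assoc (compl (tensl_comp _ _ _)).
rewrite alg_assoc -!tensr_comp -!comp_assoc (compl (assl_m _ _ _)) -htens_assoc.
rewrite -!tensl_comp -!comp_assoc; do 2 congr (_ ∘ _).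
rewrite !comp_assoc; congr (_ ∘ _); coh.
Qed.

Definition can : Hom (tens_over_ob coinv_rmod coinv_bimod) (A ⊗ C) :=
  proj1_sig (coequalizer_lift (tens_over_coequalizer coinv_rmod coinv_bimod)
               can_subproof).

Lemma canE : can ∘ tens_over_quo coinv_rmod coinv_bimod = can_pre.
Proof. exact: (proj2_sig (coequalizer_lift _ _)). Qed.

(* The canonical morphism is automatically a morphism of [A]-corings, so it is an
   isomorphism of [A]-corings as soon as it is invertible as a morphism of [V]. *)
Definition is_galois : Prop := is_iso can.

Context (Hg : is_grouplike g).

Lemma gcoact_comodule : is_comodule (C := C) gcoact.
Proof.
split.
- rewrite /gcoact -!comp_assoc 2!comp_assoc (entw_counit (entw_axioms E)).
  rewrite -!comp_assoc (compl (tensl_comp _ _ _)) (proj1 Hg) htens_id comp_idl.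
  exact: unl'K.
- rewrite /gcoact -!comp_assoc (compl (entw_comul (entw_axioms E))) -!comp_assoc.
  rewrite (compl (tensl_comp _ _ _)) (proj2 Hg) -!tensl_comp -!comp_assoc.
  rewrite (compl (htens_assoc _ _ _)) -!comp_assoc; do 2 congr (_ ∘ _).
  have -> : unl' A ⊠ idm (C : V) = assl unit_ob A C ∘ unl' (A ⊗ C) by coh.
  rewrite -!comp_assoc unl'_nat -!tensr_comp -!comp_assoc (comp_assoc ((g ⊠ _) ⊠ _)).
  rewrite -assl_l -!comp_assoc (compl (htens_lr _ _)).
  rewrite !(comp_assoc (_ ⊠ lam)) -!htens_comp comp_idl comp_idr.
  do 2 congr (_ ∘ _); coh.
Qed.

Lemma gcoact_lact :
  gcoact ∘ bim_lact coinv_bimod =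
  (bim_lact coinv_bimod ⊠ idm (C : V)) ∘
    (assl coinv_ob A C ∘ (idm coinv_ob ⊠ gcoact)).
Proof.
rewrite /= gcoact_left -(htens_lr coinv_incl) (comp_assoc (assl _ _ _)) assl_l.
by rewrite -!comp_assoc (compl (tensl_comp _ _ _)).
Qed.

Lemma Fbar_coact_subproof (X : RightModule coinv_alg) :
  let h := (tens_over_quo X coinv_bimod ⊠ idm (C : V)) ∘
    assl X A C ∘ (idm (X : V) ⊠ gcoact) in
  h ∘ tens_over_pair1 X coinv_bimod = h ∘ tens_over_pair2 X coinv_bimod.
Proof.
rewrite /tens_over_pair1 /tens_over_pair2 -!comp_assoc htens_rl.
rewrite (compl (tensr_comp _ _ _)) gcoact_lact -(tensr_comp _ (_ ⊠ _)) -(tensr_comp _ (assl _ _ _)).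
rewrite -!comp_assoc (compl (assl_m _ _ _)) -(htens_lr (mod_act X)) -?comp_assoc (compl (assl_l _ _ _)) -!comp_assoc.
rewrite !(compl (tensl_comp _ _ _)) (tens_over_quoE X coinv_bimod).
rewrite -!tensl_comp -!comp_assoc; do 2 congr (_ ∘ _).
rewrite -assr_r !comp_assoc; congr (_ ∘ _); coh.
Qed.

(* The coaction [X ⊗_{A^C} g_A], where the target [X ⊗_{A^C} (A ⊗ C)] is identified
   with [(X ⊗_{A^C} A) ⊗ C]. *)
Definition Fbar_coact (X : RightModule coinv_alg) :
    Hom (tens_over_ob X coinv_bimod) (tens_over_ob X coinv_bimod ⊗ C) :=
  proj1_sig (coequalizer_lift (tens_over_coequalizer X coinv_bimod)
               (Fbar_coact_subproof X)).

Lemma Fbar_coactE (X : RightModule coinv_alg) :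
  Fbar_coact X ∘ tens_over_quo X coinv_bimod =
  (tens_over_quo X coinv_bimod ⊠ idm (C : V)) ∘
    assl X A C ∘ (idm (X : V) ⊠ gcoact).
Proof. exact: (proj2_sig (coequalizer_lift _ _)). Qed.

Lemma Fbar_comodule (X : RightModule coinv_alg) : is_comodule (Fbar_coact X).
Proof.
have He := tens_over_coequalizer X coinv_bimod.
have [Hc Ha] := gcoact_comodule.
split; apply: (coequalizer_epi He); rewrite -!comp_assoc Fbar_coactE -!comp_assoc.
- rewrite (compl (htens_rl _ _)) -htens_lr -!comp_assoc (compl (htens_unitr _)).
  rewrite (comp_assoc (idm _ ⊠ _)) -assl_r -!comp_assoc tensr_comp.
  rewrite (comp_assoc (unr _)).
  have -> : unr (X ⊗ A) ∘ assl X A unit_ob = idm (X : V) ⊠ unr A by coh.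
  by rewrite tensr_comp comp_assoc Hc htens_id comp_idl comp_idr.
- rewrite (compl (tensl_comp _ _ _)) Fbar_coactE -!tensl_comp -!comp_assoc.
  rewrite (compl (assr_l _ _ _)) -!comp_assoc.
  rewrite (comp_assoc ((idm _ ⊠ gcoact) ⊠ _)) -assl_m -!comp_assoc tensr_comp.
  rewrite (compl (htens_rl _ _)) -(htens_lr (tens_over_quo X coinv_bimod) (coalg_comul C)) -!comp_assoc.
  rewrite (comp_assoc (idm _ ⊠ coalg_comul C)) -assl_r -!comp_assoc tensr_comp -Ha.
  rewrite -comp_assoc -(tensr_comp _ (assr _ _ _)) !comp_assoc; congr (_ ∘ _).
  rewrite -!comp_assoc; congr (_ ∘ _); coh.
Qed.

Lemma Fbar_compat (X : RightModule coinv_alg) :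
  Fbar_coact X ∘ mod_act (tens_over X coinv_bimod) =
  (mod_act (tens_over X coinv_bimod) ⊠ idm (C : V)) ∘
    assl (tens_over X coinv_bimod) A C ∘
    (idm (tens_over X coinv_bimod : V) ⊠ lam) ∘
    assr (tens_over X coinv_bimod) C A ∘ (Fbar_coact X ⊠ idm (A : V)).
Proof.
apply: (coequalizer_epi (tens_over_coequalizer_tens X coinv_bimod A)).
rewrite /= -!comp_assoc (tens_over_actE X coinv_bimod) tensl_comp Fbar_coactE.
rewrite -!comp_assoc (compl (Fbar_coactE _)) -!comp_assoc (compl (tensr_comp _ _ _)).
rewrite gcoact_mul -!comp_assoc -(tensr_comp _ (alg_mul A ⊠ _)).
rewrite -(tensr_comp _ (assl _ _ _)) -(tensr_comp _ (idm _ ⊠ lam)).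
rewrite -(tensr_comp _ (assr _ _ _)) -!comp_assoc (compl (assl_m _ _ _)).
rewrite -(tensl_comp _ (tens_over_quo _ _ ⊠ _)) -(tensl_comp _ (assl _ _ _)).
rewrite -!comp_assoc (compl (assr_l _ _ _)) -!comp_assoc (compl (htens_rl _ _)).
rewrite -(htens_lr (tens_over_quo X coinv_bimod) lam) -!comp_assoc.
rewrite (compl (assl_l _ _ _)) -!comp_assoc.
rewrite (compl (tensl_comp _ (tens_over_act _ _) _)) (tens_over_actE X coinv_bimod).
rewrite -(tensl_comp _ (_ ∘ _)) -(tensl_comp _ (tens_over_quo _ _)) -!comp_assoc.
do 2 congr (_ ∘ _).
have -> : idm (X ⊗ A) ⊠ lam =
    assl X A (A ⊗ C) ∘ ((idm (X : V) ⊠ (idm (A : V) ⊠ lam)) ∘ assr X A (C ⊗ A)).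
  by rewrite -assr_r comp_assoc assrK comp_idl.
rewrite -assr_m -!comp_assoc !comp_assoc; congr (_ ∘ _).
rewrite -!comp_assoc [LHS]comp_assoc 2![RHS]comp_assoc.
refine (f_equal2 _ _ (f_equal2 _ (eq_refl _) _)); coh.
Qed.

Definition Fbar_ob (X : RightModule coinv_alg) : EntwinedModule E :=
  {| emod_mod := tens_over X coinv_bimod; emod_coact := Fbar_coact X;
     emod_comodule := Fbar_comodule X; emod_compat := Fbar_compat X |}.

Lemma Fbar_map_comodule_morphism (X Y : RightModule coinv_alg)
    (f : @Hom (ModCat coinv_alg) X Y) :
  is_comodule_morphism (Fbar_coact X) (Fbar_coact Y) (tens_over_map_ob coinv_bimod f).
Proof.
apply: (coequalizer_epi (tens_over_coequalizer X coinv_bimod)).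
rewrite -!comp_assoc tens_over_mapE Fbar_coactE -!comp_assoc.
rewrite (compl (tensl_comp _ _ _)) tens_over_mapE (compl (Fbar_coactE _)) -!comp_assoc.
rewrite htens_rl -(htens_lr (proj1_sig f)) (comp_assoc (assl _ _ _)) assl_l -!comp_assoc.
by rewrite (compl (tensl_comp _ _ _)).
Qed.

Definition Fbar : Functor (ModCat coinv_alg) (EntwinedCat E).
Proof.
refine {|
  fobj := Fbar_ob : ModCat coinv_alg -> EntwinedCat E;
  fmap := fun X Y f => exist _ (tens_over_map_ob coinv_bimod f)
    (conj (tens_over_map_morphism coinv_bimod f) (Fbar_map_comodule_morphism f)) |}.
- move=> X; apply: sig_ext.
  exact: (f_equal (@proj1_sig _ _) (fmap_id (tens_over_functor coinv_bimod) X)).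
- move=> X Y Z h f; apply: sig_ext.
  exact: (f_equal (@proj1_sig _ _) (fmap_comp (tens_over_functor coinv_bimod) h f)).
Defined.
End Coinvariants.
Arguments Fbar {V E g} Hg.

(* Main.v *)
From Stdlib Require Import ssreflect IndefiniteDescription.
Require Import Defs.

(** Write [B] for the algebra of coinvariants [A^C], and [T M = M ⊗ C] for the cofree
    entwined module on an [A]-module [M], with action [(m ⊗ c) a = m λ(c ⊗ a)]. Two
    universal properties carry the proof. A linear map [f] on [N ⊗_B A] is determined
    by the [f(n ⊗ 1)] (lemma [ext_unit_epi]), and a morphism of entwined modules into
    [T M] is determined by its composite with [M ⊗ ε] (lemma [cofree_ext]). They
    reduce almost all identities about quotients and coactions to short calculations
    with [n ⊗ 1] and with the group-like [g].

    The functor [Fbar] has a right adjoint, [X ↦ X^co], the equalizer of the coaction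
    of [X] and [x ↦ x ⊗ g], with counit [x ⊗ a ↦ x a] and unit [n ↦ n ⊗ 1].

    Suppose that [A] is Galois and faithfully flat. The canonical map has a version
    [m ⊗ a ↦ m g_A(a)] from [M ⊗_B A] to [T M] for every [A]-module [M], and it is
    invertible because it is for [M = A] ([can_map_iso]). Tensor the equalizer
    [X^co -> X ⇉ X ⊗ C] with [A] over [B]. By flatness it remains an equalizer, and the
    canonical maps of [X] and [T X] identify its parallel pair with the pair
    [T X ⇉ T (T X)], whose equalizer is the coaction [X -> T X], by coassociativity and
    the counit. The resulting comparison is the counit of the adjunction, which is
    therefore invertible ([adj_counit_iso]). By a triangle identity the unit becomes
    invertible after tensoring with [A], so conservativity makes it invertible.

    Conversely suppose that [Fbar] is an equivalence; it then preserves equalizers and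
    reflects isomorphisms. As [C] is flat, equalizers of entwined modules are computed
    as for [A]-modules ([emod_forget_preserves_equalizers]), and a morphism of
    entwined modules that is invertible in [A]-modules is invertible. Composing,
    [- ⊗_B A] preserves equalizers and is conservative. For the Galois property,
    the two universal properties give natural bijections between [B]-linear maps
    [N -> A], linear maps [N ⊗_B A -> A], and maps [Fbar N -> T A]; the composite
    bijection is [h ↦ can ∘ Fbar h]. Since [T A] is isomorphic to some
    [Fbar N], this forces [can] to be invertible ([representing_iso]). *)

Set Implicit Arguments.
Unset Strict Implicit.
Unset Printing Implicit Defensive.

(** * Isomorphisms, equalizers and equivalences *)

Section Isomorphisms.
Context {C : Category}.

Lemma iso_comp (X Y Z : C) (g : Hom Y Z) (f : Hom X Y) :
  is_iso g -> is_iso f -> is_iso (g ∘ f).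
Proof.
move=> [g' [Gl Gr]] [f' [Fl Fr]]; exists (f' ∘ g'); split.
- by rewrite -comp_assoc (compl Gl) comp_idl.
- by rewrite -comp_assoc (compl Fr) comp_idl.
Qed.

Lemma iso_mono (X Y Z : C) (f : Hom X Y) (u v : Hom Z X) :
  is_iso f -> f ∘ u = f ∘ v -> u = v.
Proof.
by move=> [f' [Fl _]] H; rewrite -[u]comp_idl -[v]comp_idl -Fl -!comp_assoc H.
Qed.

Lemma iso_right_factor (X Y Z : C) (g : Hom Y Z) (f : Hom X Y) :
  is_iso g -> is_iso (g ∘ f) -> is_iso f.
Proof.
move=> Hg [h [Hl Hr]]; exists (h ∘ g); split; first by rewrite -comp_assoc.
by apply: (iso_mono Hg); rewrite comp_assoc comp_assoc Hr comp_idl comp_idr.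
Qed.

Lemma iso_left_factor (X Y Z : C) (g : Hom Y Z) (f : Hom X Y) :
  is_iso f -> is_iso (g ∘ f) -> is_iso g.
Proof.
move=> [f' [Fl Fr]] Hgf.
have -> : g = (g ∘ f) ∘ f' by rewrite -comp_assoc Fr comp_idr.
by apply: iso_comp => //; exists f.
Qed.

Lemma iso_cancel_section (X Y : C) (r : Hom Y X) (s : Hom X Y) :
  is_iso r -> r ∘ s = idm X -> is_iso s.
Proof.
move=> Hr H; apply: (iso_right_factor Hr); rewrite H.
by exists (idm X); rewrite comp_idl.
Qed.

Lemma equalizer_iso (K K' X Y : C) (f g : Hom X Y) (e : Hom K X) (u : Hom K' K) :
  is_equalizer f g e -> is_iso u -> is_equalizer f g (e ∘ u).
Proof.
move=> He [v [Hl Hr]]; split; first by rewrite !comp_assoc (proj1 He).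
move=> Z h Hh; have [w Hw] := equalizer_lift He Hh.
exists (v ∘ w); split; first by rewrite -comp_assoc (compl Hr) comp_idl.
move=> w' Hw'; have <- : u ∘ w' = w.
  by apply: (equalizer_mono He); rewrite comp_assoc Hw' Hw.
by rewrite comp_assoc Hl comp_idl.
Qed.

Lemma equalizer_unique (K K' X Y : C) (f g : Hom X Y) (e : Hom K X) (e' : Hom K' X) :
  is_equalizer f g e -> is_equalizer f g e' ->
  exists u : Hom K' K, is_iso u /\ e ∘ u = e'.
Proof.
move=> He He'.
have [u Hu] := equalizer_lift He (proj1 He').
have [v Hv] := equalizer_lift He' (proj1 He).
exists u; split=> //; exists v; split.
- by apply: (equalizer_mono He'); rewrite comp_assoc Hv Hu comp_idr.
- by apply: (equalizer_mono He); rewrite comp_assoc Hu Hv comp_idr.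
Qed.

(** The comparison [b] serves to detect which maps are equalized, for which monicity
    suffices. *)
Lemma equalizer_comparison_iso (K1 X1 Y1 K2 X2 Y2 : C)
    (f1 g1 : Hom X1 Y1) (e1 : Hom K1 X1) (f2 g2 : Hom X2 Y2) (e2 : Hom K2 X2)
    (a : Hom X1 X2) (b : Hom Y1 Y2) (u : Hom K1 K2) :
  is_equalizer f1 g1 e1 -> is_equalizer f2 g2 e2 ->
  is_iso a -> (forall Z (v w : Hom Z Y1), b ∘ v = b ∘ w -> v = w) ->
  b ∘ f1 = f2 ∘ a -> b ∘ g1 = g2 ∘ a -> e2 ∘ u = a ∘ e1 -> is_iso u.
Proof.
move=> He1 He2 Ha Hb Hf Hg Hu.
have [a' [Hl Hr]] := Ha.
have Hk : f1 ∘ (a' ∘ e2) = g1 ∘ (a' ∘ e2).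
  apply: Hb; rewrite !comp_assoc Hf Hg -!comp_assoc !(compl Hr) comp_idl.
  exact: (proj1 He2).
have [v Hv] := equalizer_lift He1 Hk.
exists v; split.
- apply: (equalizer_mono He1); rewrite comp_assoc Hv -comp_assoc Hu comp_idr.
  by rewrite comp_assoc Hl comp_idl.
- apply: (equalizer_mono He2); rewrite comp_assoc Hu -comp_assoc Hv comp_idr.
  by rewrite comp_assoc Hr comp_idl.
Qed.

End Isomorphisms.

Section Equivalences.
Context {C D : Category}.

Definition faithful (F : Functor C D) : Prop :=
  forall (X Y : C) (f f' : Hom X Y), fmap F f = fmap F f' -> f = f'.

Definition full (F : Functor C D) : Prop :=
  forall (X Y : C) (h : Hom (F X) (F Y)), exists f : Hom X Y, fmap F f = h.

Definition essentially_surjective (F : Functor C D) : Prop :=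
  forall Z : D, exists (X : C) (z : Hom (F X) Z), is_iso z.

Lemma fmap_iso (F : Functor C D) (X Y : C) (f : Hom X Y) :
  is_iso f -> is_iso (fmap F f).
Proof.
by move=> [f' [Hl Hr]]; exists (fmap F f'); rewrite -!fmap_comp Hl Hr !fmap_id.
Qed.

Lemma naturally_isomorphic_sym (F G : Functor C D) :
  naturally_isomorphic F G -> naturally_isomorphic G F.
Proof.
move=> [eta [Hi Hn]].
have inv X := constructive_indefinite_description _ (Hi X).
exists (fun X => proj1_sig (inv X)); split.
- by move=> X; case: (inv X) => k [Hl Hr]; exists (eta X).
- move=> X Y f; case: (inv X) (inv Y) => k [Kl Kr] [l [Ll Lr]] /=.
  rewrite -[_ ∘ k]comp_idl -Ll -!comp_assoc (compl (Hn _ _ f)) -!comp_assoc.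
  by rewrite Kr comp_idr.
Qed.
End Equivalences.

(** Stated for one half of an equivalence, so as to apply to both of its functors. *)
Lemma faithful_of_retraction (C D : Category) (F : Functor C D) (G : Functor D C) :
  naturally_isomorphic (functor_comp G F) (functor_id C) -> faithful F.
Proof.
move=> [eta [Hi Hn]] X Y f f' H.
have [k [_ Hk]] := Hi X; move: (Hn _ _ f) (Hn _ _ f') => /= Nf Nf'.
by rewrite -[f]comp_idr -[f']comp_idr -Hk !comp_assoc -Nf -Nf' H.
Qed.

(** The preimage of [h] is [G h] conjugated by [G F ≅ 1]; it maps to [h] because it
    does so after applying [G], which is faithful by the other isomorphism. *)
Lemma equivalence_full (C D : Category) (F : Functor C D) :
  is_equivalence F -> full F.
Proof.
move=> [G [GF FG]] X Y h.
have Gf : faithful G by exact: (faithful_of_retraction FG).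
have [eta [Hi Hn]] := GF; have [k [Hk Hk']] := Hi X.
exists (eta Y ∘ fmap G h ∘ k); apply: Gf; apply: (iso_mono (Hi Y)).
by rewrite (Hn _ _ (eta Y ∘ fmap G h ∘ k)) /= -comp_assoc Hk comp_idr.
Qed.

Section EquivalenceConsequences.
Context {C D : Category} (F : Functor C D) (HF : is_equivalence F).

Lemma equivalence_faithful : faithful F.
Proof. by case: HF => G [GF _]; exact: (faithful_of_retraction GF). Qed.

Lemma equivalence_essentially_surjective : essentially_surjective F.
Proof. by case: HF => G [_ [th [Hi _]]] Z; exists (G Z), (th Z); exact: Hi. Qed.

Lemma equivalence_conservative : conservative F.
Proof.
move=> X Y f [h [Hl Hr]]; have [k Hk] := equivalence_full HF h.
by exists k; split; apply: equivalence_faithful; rewrite fmap_comp Hk fmap_id.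
Qed.

Lemma equivalence_preserves_equalizers : preserves_equalizers F.
Proof.
move=> K X Y f g e He; split; first by rewrite -!fmap_comp (proj1 He).
move=> Z h Hh.
have [Z' [z Hz]] := equivalence_essentially_surjective Z.
have [h' Hh'] := equivalence_full HF (h ∘ z).
have [u Hu] : {u | e ∘ u = h'}.
  apply: (equalizer_lift He); apply: equivalence_faithful.
  by rewrite !fmap_comp Hh' !comp_assoc Hh.
have [z' [Zl Zr]] := Hz.
exists (fmap F u ∘ z'); split.
- by rewrite comp_assoc -fmap_comp Hu Hh' -comp_assoc Zr comp_idr.
- move=> w Hw; have [w' Hw'] := equivalence_full HF (w ∘ z).
  have <- : w' = u.
    apply: (equalizer_mono He); rewrite Hu; apply: equivalence_faithful.
    by rewrite fmap_comp Hw' Hh' comp_assoc Hw.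
  by rewrite Hw' -comp_assoc Zr comp_idr.
Qed.
End EquivalenceConsequences.

(** If [c] represents the maps from the image of [F] to [Z], then [R] is the object
    whose image is [Z]: the map [h] corresponding to an isomorphism [F X ≅ Z] is
    inverse to the preimage [k] of [c] under [F]. *)
Lemma representing_iso (C D : Category) (F : Functor C D) (R : C) (Z : D)
    (c : Hom (F R) Z) :
  full F -> essentially_surjective F ->
  (forall (Y : C) (p : Hom (F Y) Z), exists h : Hom Y R, c ∘ fmap F h = p) ->
  (forall (Y : C) (h h' : Hom Y R), c ∘ fmap F h = c ∘ fmap F h' -> h = h') ->
  is_iso c.
Proof.
move=> Ffull Fsurj ex inj.
have [X [z [z' [Hl Hr]]]] := Fsurj Z.
have [h Hh] := ex X z; have [k Hk] := Ffull _ _ (z' ∘ c).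
have hk : h ∘ k = idm R.
  apply: inj; rewrite fmap_comp comp_assoc Hh Hk comp_assoc Hr comp_idl.
  by rewrite fmap_id comp_idr.
exists (fmap F h ∘ z'); split; last by rewrite comp_assoc Hh.
by rewrite -comp_assoc -Hk -fmap_comp hk fmap_id.
Qed.

(** * Calculations up to transported identities *)

Ltac merge_idto :=
  rewrite -?comp_assoc ?idto_tensl ?idto_tensr ?idto_tensl ?idto_tensr;
  rewrite ?(compl (idto_comp _ _)) ?idto_comp.
(** Proves equal two composites of the same morphisms interleaved with different
    transported identities, where [coh] expects transported identities alone. *)
Ltac coherence :=
  merge_idto; rewrite ?idto_id ?comp_idl ?comp_idr;
  repeat first [reflexivity | exact: idto_irr | apply: (f_equal2 comp)].

Lemma comp_square (C : Category) (X X' Y Z W : C) (g : Hom Y Z) (f : Hom X Y)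
    (h : Hom X' Z) (k : Hom X X') (E : g ∘ f = h ∘ k) (x : Hom W X) :
  g ∘ (f ∘ x) = h ∘ (k ∘ x).
Proof. by rewrite !comp_assoc E. Qed.

(** * Modules *)

Lemma module_morphism_comp (V : StrictMonoidalCategory) (A : Algebra V)
    (X Y Z : RightModule A) (f : Hom X Y) (h : Hom Y Z) :
  is_module_morphism (X := X) (Y := Y) f -> is_module_morphism (X := Y) (Y := Z) h ->
  is_module_morphism (X := X) (Y := Z) (h ∘ f).
Proof.
move=> Lf Lh; rewrite /is_module_morphism -comp_assoc Lf comp_assoc Lh -comp_assoc.
by rewrite tensl_comp.
Qed.

Lemma mod_act_mul (V : StrictMonoidalCategory) (A : Algebra V) (M : RightModule A) :
  mod_act M ∘ (idm (M : V) ⊠ alg_mul A) =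
  mod_act M ∘ (mod_act M ⊠ idm (A : V)) ∘ assl M A A.
Proof. by rewrite mod_assoc -comp_assoc asslK comp_idr. Qed.

Section ModuleEqualizers.
Context {V : StrictMonoidalCategory} {A : Algebra V} {X Y : RightModule A}.
Context (f h : @Hom (ModCat A) X Y) {K : V} {e : Hom K X}.
Context (He : is_equalizer (proj1_sig f) (proj1_sig h) e).

Lemma equalizer_act_subproof :
  proj1_sig f ∘ (mod_act X ∘ (e ⊠ idm (A : V))) =
  proj1_sig h ∘ (mod_act X ∘ (e ⊠ idm (A : V))).
Proof.
rewrite !comp_assoc (proj2_sig f) (proj2_sig h) -!comp_assoc !tensl_comp.
by rewrite (proj1 He).
Qed.

Definition equalizer_act : Hom (K ⊗ A) K :=
  proj1_sig (equalizer_lift He equalizer_act_subproof).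

Lemma equalizer_actE : e ∘ equalizer_act = mod_act X ∘ (e ⊠ idm (A : V)).
Proof. exact: (proj2_sig (equalizer_lift _ _)). Qed.

Definition equalizer_module : RightModule A.
Proof.
refine {| mod_ob := K; mod_act := equalizer_act |}; apply: (equalizer_mono He).
- rewrite comp_assoc equalizer_actE -comp_assoc htens_lr -htens_rl comp_assoc.
  by rewrite mod_unit htens_unitr.
- rewrite !comp_assoc equalizer_actE -!comp_assoc tensl_comp equalizer_actE.
  rewrite -tensl_comp comp_assoc mod_assoc -!comp_assoc htens_assoc.
  by rewrite htens_id (compl (htens_lr _ _)) (compl (htens_rl _ _)).
Defined.

Definition equalizer_module_incl : @Hom (ModCat A) equalizer_module X :=
  exist _ e equalizer_actE.

Lemma equalizer_module_equalizer : is_equalizer f h equalizer_module_incl.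
Proof.
split; first by apply: sig_ext; exact: (proj1 He).
move=> Z k Hk.
have [u Hu] := equalizer_lift He (f_equal (@proj1_sig _ _) Hk).
have Lu : is_module_morphism (X := Z) (Y := equalizer_module) u.
  apply: (equalizer_mono He); rewrite comp_assoc Hu (proj2_sig k) comp_assoc.
  by rewrite equalizer_actE -comp_assoc tensl_comp Hu.
exists (exist _ u Lu); split; first by apply: sig_ext.
move=> w Hw; apply: sig_ext; apply: (equalizer_mono He).
by rewrite /= Hu -Hw.
Qed.
End ModuleEqualizers.

Lemma module_inverse (V : StrictMonoidalCategory) (A : Algebra V) (X Y : RightModule A)
    (f : Hom X Y) (k : Hom Y X) :
  is_module_morphism (X := X) (Y := Y) f -> k ∘ f = idm (X : V) ->
  f ∘ k = idm (Y : V) -> is_module_morphism (X := Y) (Y := X) k.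
Proof.
move=> Lf Hl Hr; rewrite /is_module_morphism -[LHS]comp_idr -htens_id -Hr.
by rewrite -tensl_comp comp_assoc -(comp_assoc k) -Lf (comp_assoc k) Hl comp_idl.
Qed.

Lemma module_iso (V : StrictMonoidalCategory) (A : Algebra V) (X Y : RightModule A)
    (f : @Hom (ModCat A) X Y) : is_iso (proj1_sig f) -> is_iso f.
Proof.
case: f => f Lf [k [Hl Hr]].
exists (exist _ k (module_inverse (X := X) (Y := Y) Lf Hl Hr)).
by split; apply: sig_ext.
Qed.

Lemma module_iso_underlying (V : StrictMonoidalCategory) (A : Algebra V)
    (X Y : RightModule A) (f : @Hom (ModCat A) X Y) : is_iso f -> is_iso (proj1_sig f).
Proof.
move=> [k [Hl Hr]]; exists (proj1_sig k); split.
- exact: (f_equal (@proj1_sig _ _) Hl).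
- exact: (f_equal (@proj1_sig _ _) Hr).
Qed.

Section Restriction.
Context {V : StrictMonoidalCategory} {R S : Algebra V} {i : Hom R S}.
Context (Hi : is_algebra_morphism i).

Definition restrict (M : RightModule S) : RightModule R.
Proof.
refine {| mod_ob := M; mod_act := mod_act M ∘ (idm (M : V) ⊠ i) |}.
- by rewrite -comp_assoc tensr_comp (proj1 Hi) mod_unit.
- rewrite -!comp_assoc (compl (tensr_comp _ _ _)) (proj2 Hi) -tensl_comp.
  rewrite (compl (htens_rl _ _)) -htens_lr -!comp_assoc htens_rl -tensr_comp.
  rewrite -!comp_assoc -htens_assoc.
  by rewrite [RHS]comp_assoc [in RHS]comp_assoc -mod_assoc -!comp_assoc.
Defined.

Lemma restrict_morphism (M M' : RightModule S) (f : Hom M M') :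
  is_module_morphism (X := M) (Y := M') f ->
  is_module_morphism (X := restrict M) (Y := restrict M') f.
Proof.
move=> Lf; rewrite /is_module_morphism /= comp_assoc Lf -!comp_assoc.
by rewrite htens_lr htens_rl.
Qed.
End Restriction.

Definition regular_module (V : StrictMonoidalCategory) (A : Algebra V) :
    RightModule A :=
  {| mod_ob := A : V; mod_act := alg_mul A; mod_unit := alg_unitr A;
     mod_assoc := alg_assoc A |}.

(** * Cofree entwined modules *)

Section Cofree.
Context {V : StrictMonoidalCategory} {E : Entwining V}.
Notation A := (entw_alg E).
Notation C := (entw_coalg E).
Notation lam := (entw_map E).

(** The entwining lifts the comonad [- ⊗ C] from [V] to the right [A]-modules:
    [(m ⊗ c) a = m a_λ ⊗ c^λ] on [M ⊗ C]. Entwined modules are the coalgebras of the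
    lifted comonad. *)
Definition twisted_act (M : RightModule A) : Hom ((M ⊗ C) ⊗ A) (M ⊗ C) :=
  (mod_act M ⊠ idm (C : V)) ∘ assl M A C ∘ (idm (M : V) ⊠ lam) ∘ assr M C A.

Definition twisted (M : RightModule A) : RightModule A.
Proof.
refine {| mod_ob := M ⊗ C : V; mod_act := twisted_act M |}.
- have U := entw_unit (entw_axioms E).
  have U' : lam ∘ (idm (C : V) ⊠ alg_unit A) =
      (alg_unit A ⊠ idm (C : V)) ∘ unl' C ∘ unr C.
    by rewrite -U -comp_assoc unrK comp_idr.
  rewrite /twisted_act -!comp_assoc -htens_id htens_assoc (compl (tensr_comp _ _ _)).
  rewrite U' -!tensr_comp -!comp_assoc (compl (assl_m _ _ _)) -!comp_assoc.
  rewrite (compl (tensl_comp _ _ _)) mod_unit.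
  coherence.
- have Mu := entw_mul (entw_axioms E).
  rewrite /twisted_act -!comp_assoc -(htens_id M C) (compl (htens_assoc _ _ _)).
  rewrite -!comp_assoc (compl (tensr_comp _ _ _)) Mu -!tensr_comp -!comp_assoc.
  rewrite (compl (assl_m _ _ _)) -!comp_assoc (compl (tensl_comp _ _ _)).
  rewrite mod_act_mul -!tensl_comp -!comp_assoc; congr (_ ∘ _).
  rewrite (compl (assr_l _ _ _)) -!comp_assoc (compl (htens_rl _ _)).
  rewrite -(htens_lr (mod_act M) lam) -!comp_assoc (compl (assl_l _ _ _)) -!comp_assoc.
  congr (_ ∘ _).
  rewrite -(htens_id M A).
  have -> : (idm (M : V) ⊠ idm (A : V)) ⊠ lam =
      assl M A (A ⊗ C) ∘ (idm (M : V) ⊠ (idm (A : V) ⊠ lam)) ∘ assr M A (C ⊗ A).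
    by rewrite -comp_assoc -htens_assoc comp_assoc assrK comp_idl.
  have -> : (idm (M : V) ⊠ lam) ⊠ idm (A : V) =
      assl M (A ⊗ C) A ∘ (idm (M : V) ⊠ (lam ⊠ idm (A : V))) ∘ assr M (C ⊗ A) A.
    by rewrite -comp_assoc -assr_m comp_assoc assrK comp_idl.
  coherence.
Defined.

Lemma twisted_map (M M' : RightModule A) (f : Hom M M') :
  is_module_morphism (X := M) (Y := M') f ->
  is_module_morphism (X := twisted M) (Y := twisted M') (f ⊠ idm (C : V)).
Proof.
move=> Lf; rewrite /is_module_morphism /= /twisted_act -!comp_assoc.
rewrite (compl (tensl_comp _ _ _)) Lf -tensl_comp assr_l (compl (htens_rl _ _)).
by rewrite -(htens_lr f lam) -!comp_assoc (compl (assl_l _ _ _)) -!comp_assoc.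
Qed.

Definition cofree_coact (M : RightModule A) : Hom (M ⊗ C) ((M ⊗ C) ⊗ C) :=
  assl M C C ∘ (idm (M : V) ⊠ coalg_comul C).

Definition cofree_counit (M : RightModule A) : Hom (M ⊗ C) M :=
  unr M ∘ (idm (M : V) ⊠ coalg_counit C).

Lemma cofree_comodule (M : RightModule A) : is_comodule (cofree_coact M).
Proof.
rewrite /cofree_coact; split.
- rewrite -!comp_assoc -htens_id.
  rewrite -(comp_square (assl_nat _ _ _)) tensr_comp.
  transitivity
    (idm (M : V) ⊠ (unr C ∘ (idm (C : V) ⊠ coalg_counit C ∘ coalg_comul C))).
    rewrite -!tensr_comp; coherence.
  by rewrite comp_assoc coalg_counitr.
- rewrite -!comp_assoc -htens_id -(comp_square (assl_nat _ _ _)) tensr_comp.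
  rewrite -coalg_coassoc -!tensl_comp -!tensr_comp -!comp_assoc.
  rewrite -(comp_square (assl_m _ _ _)).
  coherence.
Qed.

Lemma cofree_compat (M : RightModule A) :
  cofree_coact M ∘ mod_act (twisted M) =
  (mod_act (twisted M) ⊠ idm (C : V)) ∘ assl (twisted M) A C ∘
    (idm (twisted M : V) ⊠ lam) ∘ assr (twisted M) C A ∘
    (cofree_coact M ⊠ idm (A : V)).
Proof.
rewrite /cofree_coact /= /twisted_act -!comp_assoc (compl (htens_rl _ _)).
rewrite -(htens_lr (mod_act M)) -!comp_assoc (compl (assl_l _ _ _)) -!comp_assoc.
rewrite -(htens_id M A) -(comp_square (assl_nat (idm (M : V)) _ _)) (compl (tensr_comp _ _ _)).
rewrite (entw_comul (entw_axioms E)) -!tensr_comp -!tensl_comp -!comp_assoc.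
congr (_ ∘ _).
rewrite -[in RHS](htens_id M C).
have -> : (idm (M : V) ⊠ idm (C : V)) ⊠ lam =
    assl M C (A ⊗ C) ∘ (idm (M : V) ⊠ (idm (C : V) ⊠ lam)) ∘ assr M C (C ⊗ A).
  by rewrite -comp_assoc -htens_assoc comp_assoc assrK comp_idl.
have -> : (idm (M : V) ⊠ lam) ⊠ idm (C : V) =
    assl M (A ⊗ C) C ∘ (idm (M : V) ⊠ (lam ⊠ idm (C : V))) ∘ assr M (C ⊗ A) C.
  by rewrite -comp_assoc -assr_m comp_assoc assrK comp_idl.
have -> : (idm (M : V) ⊠ coalg_comul C) ⊠ idm (A : V) =
    assl M (C ⊗ C) A ∘ (idm (M : V) ⊠ (coalg_comul C ⊠ idm (A : V))) ∘ assr M C A.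
  by rewrite -comp_assoc -assr_m comp_assoc assrK comp_idl.
coherence.
Qed.

Definition cofree (M : RightModule A) : EntwinedModule E :=
  {| emod_mod := twisted M; emod_coact := cofree_coact M;
     emod_comodule := cofree_comodule M; emod_compat := cofree_compat M |}.

Lemma cofree_counit_morphism (M : RightModule A) :
  is_module_morphism (X := twisted M) (Y := M) (cofree_counit M).
Proof.
rewrite /is_module_morphism /cofree_counit /= /twisted_act -!comp_assoc.
rewrite (compl (htens_rl _ _)) -htens_lr -!comp_assoc (compl (htens_unitr _)).
rewrite -!comp_assoc; congr (_ ∘ _).
rewrite -(htens_id M A) -(comp_square (assl_nat _ _ _)).
have U := entw_counit (entw_axioms E).
rewrite (compl (tensr_comp _ _ _)).
have -> : (idm (A : V) ⊠ coalg_counit C) ∘ lam =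
   unr' A ∘ (unl A ∘ (coalg_counit C ⊠ idm (A : V))).
  by rewrite -U -!comp_assoc (compl (unrK _)) comp_idl.
rewrite -!tensr_comp -!comp_assoc -assr_m -!tensl_comp.
coherence.
Qed.

Lemma cofree_counit_nat (M M' : RightModule A) (f : Hom M M') :
  cofree_counit M' ∘ (f ⊠ idm (C : V)) = f ∘ cofree_counit M.
Proof.
rewrite /cofree_counit -comp_assoc htens_rl -htens_lr comp_assoc htens_unitr.
by rewrite -comp_assoc.
Qed.

Lemma emod_counit (X : EntwinedModule E) :
  cofree_counit X ∘ emod_coact X = idm (X : V).
Proof. exact: (comod_counit (emod_comodule X)). Qed.

(** The transpose of a linear map from an entwined module along the adjunction
    between the forgetful functor to modules and [cofree]. *)
Definition cofree_transpose (X : EntwinedModule E) (M : RightModule A) (t : Hom X M) :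
    Hom X (M ⊗ C) :=
  (t ⊠ idm (C : V)) ∘ emod_coact X.

(** The compatibility axiom of an entwined module, read as linearity. *)
Lemma emod_coact_linear (X : EntwinedModule E) :
  is_module_morphism (X := X) (Y := twisted X) (emod_coact X).
Proof. exact: emod_compat. Qed.

Lemma cofree_transpose_linear (X : EntwinedModule E) (M : RightModule A) (t : Hom X M) :
  is_module_morphism (X := X) (Y := M) t ->
  is_module_morphism (X := X) (Y := twisted M) (cofree_transpose t).
Proof.
by move=> Lt; exact: (module_morphism_comp (emod_coact_linear X) (twisted_map Lt)).
Qed.

Lemma emod_coact_comul (X : EntwinedModule E) :
  (emod_coact X ⊠ idm (C : V)) ∘ emod_coact X = cofree_coact X ∘ emod_coact X.
Proof.
rewrite /cofree_coact -comp_assoc -(comod_coassoc (emod_comodule X)) !comp_assoc.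
by rewrite assrK comp_idl.
Qed.

Lemma cofree_transpose_colinear (X : EntwinedModule E) (M : RightModule A)
    (t : Hom X M) :
  is_comodule_morphism (emod_coact X) (cofree_coact M) (cofree_transpose t).
Proof.
rewrite /is_comodule_morphism /cofree_transpose -tensl_comp -[RHS]comp_assoc.
rewrite emod_coact_comul /cofree_coact -!comp_assoc (compl (htens_rl _ _)).
by rewrite -(comp_square (assl_l _ _ _)) -htens_lr -!comp_assoc.
Qed.

Lemma cofree_transposeK (X : EntwinedModule E) (M : RightModule A) (t : Hom X M) :
  cofree_counit M ∘ cofree_transpose t = t.
Proof.
rewrite /cofree_transpose comp_assoc cofree_counit_nat -comp_assoc emod_counit.
by rewrite comp_idr.
Qed.

Lemma cofree_transpose_counit (X : EntwinedModule E) (M : RightModule A)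
    (p : Hom X (M ⊗ C)) :
  is_comodule_morphism (emod_coact X) (cofree_coact M) p ->
  cofree_transpose (cofree_counit M ∘ p) = p.
Proof.
rewrite /cofree_transpose -tensl_comp -comp_assoc => <-.
rewrite /cofree_counit /cofree_coact -tensl_comp -!comp_assoc.
rewrite -(comp_square (assl_m _ _ _)) (compl (tensr_comp _ _ _)).
transitivity
  (idm (M : V) ⊠ (unl C ∘ (coalg_counit C ⊠ idm (C : V) ∘ coalg_comul C)) ∘ p).
  rewrite -!tensr_comp; coherence.
by rewrite comp_assoc coalg_counitl htens_id comp_idl.
Qed.

Lemma cofree_counit_comp_linear (X : EntwinedModule E) (M : RightModule A)
    (p : @Hom (EntwinedCat E) X (cofree M)) :
  is_module_morphism (X := X) (Y := M) (cofree_counit M ∘ proj1_sig p).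
Proof.
exact: (module_morphism_comp (proj1 (proj2_sig p)) (cofree_counit_morphism M)).
Qed.

Lemma cofree_ext (X : EntwinedModule E) (M : RightModule A)
    (p p' : @Hom (EntwinedCat E) X (cofree M)) :
  cofree_counit M ∘ proj1_sig p = cofree_counit M ∘ proj1_sig p' -> p = p'.
Proof.
case: p p' => p [Lp Cp] [p' [Lp' Cp']] H; apply: sig_ext.
change (p = p').
by rewrite -(cofree_transpose_counit Cp) -(cofree_transpose_counit Cp') H.
Qed.

Definition twisted_hom (M M' : RightModule A) (f : @Hom (ModCat A) M M') :
    @Hom (ModCat A) (twisted M) (twisted M') :=
  exist _ _ (twisted_map (proj2_sig f)).

Definition emod_coact_hom (X : EntwinedModule E) :
    @Hom (ModCat A) (emod_mod X) (twisted X) :=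
  exist _ _ (emod_coact_linear X).

(** The counit splits this pair; as it is linear, so are the lifts of linear maps. *)
Lemma emod_coact_equalizer (X : EntwinedModule E) :
  is_equalizer (twisted_hom (emod_coact_hom X)) (emod_coact_hom (cofree X))
    (emod_coact_hom X).
Proof.
split; first by apply: sig_ext; exact: emod_coact_comul.
move=> Z [h Lh] Hh.
have {Hh} H : (emod_coact X ⊠ idm (C : V)) ∘ h = cofree_coact X ∘ h.
  exact: (f_equal (@proj1_sig _ _) Hh).
have Lu := module_morphism_comp Lh (cofree_counit_morphism X).
exists (exist _ _ Lu); split=> [|[w Lw] Hw]; apply: sig_ext.
- change (emod_coact X ∘ (cofree_counit X ∘ h) = h).
  rewrite comp_assoc -(cofree_counit_nat (M' := twisted X)) -comp_assoc H.
  rewrite comp_assoc.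
  by rewrite (emod_counit (cofree X)) comp_idl.
- change (cofree_counit X ∘ h = w).
  have <- : emod_coact X ∘ w = h by exact: (f_equal (@proj1_sig _ _) Hw).
  by rewrite comp_assoc emod_counit comp_idl.
Qed.
End Cofree.

(** * Equalizers of entwined modules *)

Definition emod_forget (V : StrictMonoidalCategory) (E : Entwining V) :
  Functor (EntwinedCat E) (ModCat (entw_alg E)).
Proof.
by refine {| fobj := (fun X => emod_mod X) : EntwinedCat E -> ModCat (entw_alg E);
  fmap := fun X Y f => exist _ (proj1_sig f) (proj1 (proj2_sig f)) |} => *;
  apply: sig_ext.
Defined.

Section EntwinedEqualizers.
Context {V : StrictMonoidalCategory} {E : Entwining V}.
Notation A := (entw_alg E).
Notation C := (entw_coalg E).
Notation lam := (entw_map E).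
Context (HC : flat_object (C : V)) {X Y : EntwinedModule E}.
Context (f h : @Hom (EntwinedCat E) X Y) {K : V} {e : Hom K X}.
Context (He : is_equalizer (proj1_sig f) (proj1_sig h) e).

Let HeC : is_equalizer (proj1_sig f ⊠ idm (C : V)) (proj1_sig h ⊠ idm (C : V))
    (e ⊠ idm (C : V)) := HC He.

Let Kmod : RightModule A :=
  equalizer_module (f := fmap (emod_forget E) f) (h := fmap (emod_forget E) h) He.

Let KmodE : e ∘ mod_act Kmod = mod_act X ∘ (e ⊠ idm (A : V)) :=
  equalizer_actE (f := fmap (emod_forget E) f) (h := fmap (emod_forget E) h) He.

Lemma equalizer_coact_subproof :
  (proj1_sig f ⊠ idm (C : V)) ∘ (emod_coact X ∘ e) =
  (proj1_sig h ⊠ idm (C : V)) ∘ (emod_coact X ∘ e).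
Proof.
rewrite !comp_assoc -(proj2 (proj2_sig f)) -(proj2 (proj2_sig h)) -!comp_assoc.
by rewrite (proj1 He).
Qed.

(** Flatness of [C] enters here: [e ⊗ C] is again an equalizer, so that the coaction
    of [X] restricts to [K]. *)
Definition equalizer_coact : Hom K (K ⊗ C) :=
  proj1_sig (equalizer_lift HeC equalizer_coact_subproof).

Lemma equalizer_coactE : (e ⊠ idm (C : V)) ∘ equalizer_coact = emod_coact X ∘ e.
Proof. exact: (proj2_sig (equalizer_lift _ _)). Qed.

Lemma equalizer_comodule : is_comodule equalizer_coact.
Proof.
split.
- apply: (equalizer_mono He).
  rewrite comp_idr !comp_assoc -htens_unitr -(comp_assoc (unr X)) htens_lr.
  rewrite -htens_rl -!comp_assoc equalizer_coactE.
  by rewrite !comp_assoc (comod_counit (emod_comodule X)) comp_idl.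
- suff H : (equalizer_coact ⊠ idm (C : V)) ∘ equalizer_coact =
      assl K C C ∘ ((idm K ⊠ coalg_comul C) ∘ equalizer_coact).
    by rewrite -comp_assoc H comp_assoc asslK comp_idl.
  apply: (equalizer_mono (HC HeC)); rewrite /= (comp_assoc _ _ equalizer_coact).
  rewrite tensl_comp equalizer_coactE -tensl_comp -comp_assoc equalizer_coactE.
  rewrite comp_assoc emod_coact_comul /cofree_coact -!comp_assoc.
  rewrite -equalizer_coactE (compl (htens_rl _ _)) -(comp_square (assl_l _ _ _)).
  by rewrite (compl (htens_lr _ _)).
Qed.

Lemma equalizer_compat :
  equalizer_coact ∘ mod_act Kmod =
  (mod_act Kmod ⊠ idm (C : V)) ∘ assl Kmod A C ∘ (idm (Kmod : V) ⊠ lam) ∘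
    assr Kmod C A ∘ (equalizer_coact ⊠ idm (A : V)).
Proof.
apply: (equalizer_mono HeC).
rewrite comp_assoc equalizer_coactE -comp_assoc KmodE comp_assoc emod_compat.
rewrite -!comp_assoc (compl (tensl_comp _ _ _)) KmodE.
rewrite (tensl_comp _ (emod_coact X)) -equalizer_coactE -!tensl_comp -!comp_assoc.
rewrite (comp_square (assr_l _ _ _)) (compl (htens_rl _ _)).
by rewrite -(comp_square (assl_l _ _ e)) (compl (htens_lr _ _)).
Qed.

Definition equalizer_emod : EntwinedModule E :=
  {| emod_mod := Kmod; emod_coact := equalizer_coact;
     emod_comodule := equalizer_comodule; emod_compat := equalizer_compat |}.

Definition equalizer_emod_incl : @Hom (EntwinedCat E) equalizer_emod X :=
  exist _ e (conj KmodE (eq_sym equalizer_coactE)).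

Lemma equalizer_emod_equalizer : is_equalizer f h equalizer_emod_incl.
Proof.
split; first by apply: sig_ext; exact: (proj1 He).
move=> Z [k [Lk Ck]] Hk.
have [u Hu] := equalizer_lift He (f_equal (@proj1_sig _ _) Hk).
have Lu : is_module_morphism (X := Z) (Y := equalizer_emod) u.
  apply: (equalizer_mono He); rewrite !comp_assoc Hu Lk KmodE -comp_assoc.
  by rewrite tensl_comp Hu.
have Cu : is_comodule_morphism (emod_coact Z) (emod_coact equalizer_emod) u.
  apply: (equalizer_mono HeC); rewrite comp_assoc equalizer_coactE -comp_assoc Hu.
  by rewrite comp_assoc tensl_comp Hu.
exists (exist _ u (conj Lu Cu)); split=> [|[w Lw] Hw]; apply: sig_ext; first exact: Hu.
apply: (equalizer_mono He); rewrite /= Hu.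
by symmetry; exact: (f_equal (@proj1_sig _ _) Hw).
Qed.
End EntwinedEqualizers.

(** An equalizer in entwined modules is isomorphic to the one built from the
    equalizer of the underlying morphisms, and that one is also an equalizer of
    modules. *)
Lemma emod_forget_preserves_equalizers (V : BaseCategory) (E : Entwining V) :
  flat_object (entw_coalg E : V) -> preserves_equalizers (emod_forget E).
Proof.
move=> HC K X Y f h e He.
have [K' [e' He']] := has_equalizers (proj1_sig f) (proj1_sig h).
have [u [Hu <-]] := equalizer_unique (equalizer_emod_equalizer HC He') He.
rewrite fmap_comp; apply: equalizer_iso; last exact: fmap_iso.
set f' := fmap (emod_forget E) f; set h' := fmap (emod_forget E) h.
have -> : fmap (emod_forget E) (equalizer_emod_incl HC He') =
    equalizer_module_incl (f := f') (h := h') He' by exact: sig_ext.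
exact: equalizer_module_equalizer.
Qed.

Lemma emod_iso (V : StrictMonoidalCategory) (E : Entwining V)
    (X Y : EntwinedModule E) (f : @Hom (EntwinedCat E) X Y) :
  is_iso (proj1_sig f) -> is_iso f.
Proof.
case: f => f [Lf Cf] [k [Hl Hr]]; rewrite /= in Hl Hr.
have Lk : is_module_morphism (X := Y) (Y := X) k.
  exact: (module_inverse (X := X) (Y := Y) Lf Hl Hr).
have Ck : is_comodule_morphism (emod_coact Y) (emod_coact X) k.
  rewrite /is_comodule_morphism -[_ ∘ k]comp_idl -htens_id -Hl -tensl_comp.
  by rewrite -comp_assoc (comp_assoc (f ⊠ _)) -Cf -comp_assoc Hr comp_idr.
by exists (exist _ k (conj Lk Ck)); split; apply: sig_ext.
Qed.

Lemma emod_iso_underlying (V : StrictMonoidalCategory) (E : Entwining V)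
    (X Y : EntwinedModule E) (f : @Hom (EntwinedCat E) X Y) :
  is_iso f -> is_iso (proj1_sig f).
Proof.
move=> [k [Hl Hr]]; exists (proj1_sig k); split.
- exact: (f_equal (@proj1_sig _ _) Hl).
- exact: (f_equal (@proj1_sig _ _) Hr).
Qed.

(** * Extension of scalars from the coinvariants *)

Section Extension.
Context {V : BaseCategory} {E : Entwining V}.
Notation A := (entw_alg E).
Notation C := (entw_coalg E).
Context (g : Hom unit_ob C).
Notation B := (coinv_alg g).
Notation i := (coinv_incl g).
Notation P := (coinv_bimod g).
Notation restr := (restrict (coinv_incl_morphism g)).

Definition ext_unit (N : RightModule B) : Hom N (tens_over_ob N P) :=
  tens_over_quo N P ∘ (idm (N : V) ⊠ alg_unit A) ∘ unr' N.

Lemma ext_unit_act (N : RightModule B) :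
  tens_over_act N P ∘ (ext_unit N ⊠ idm (A : V)) = tens_over_quo N P.
Proof.
rewrite /ext_unit -!tensl_comp -!comp_assoc (compl (tens_over_actE _ _)) -!comp_assoc.
rewrite (comp_square (assr_m _ _ _)) (compl (tensr_comp _ _ _)) /= alg_unitl.
rewrite -[RHS]comp_idr; congr (_ ∘ _); coherence.
Qed.

Lemma ext_unit_linear (N : RightModule B) :
  is_module_morphism (X := N) (Y := restr (tens_over N P)) (ext_unit N).
Proof.
rewrite /is_module_morphism /= -comp_assoc htens_rl -htens_lr comp_assoc ext_unit_act.
rewrite /ext_unit -!comp_assoc unr'_nat (compl (htens_rl _ _)) -htens_lr -!comp_assoc.
rewrite (compl (tens_over_quoE _ _)) -!comp_assoc; congr (_ ∘ _).
rewrite (comp_square (assr_r _ _ _)) (compl (tensr_comp _ _ _)) /= -comp_assoc htens_lr.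
rewrite -(htens_rl i) (comp_assoc (alg_mul A)) alg_unitr htens_unitr -tensr_comp.
rewrite -[RHS]comp_idr -comp_assoc; congr (_ ∘ _); coherence.
Qed.

Definition ext_unit_hom (N : RightModule B) :
    @Hom (ModCat B) N (restr (tens_over N P)) :=
  exist _ _ (ext_unit_linear N).

(** As [n ⊗ a] is [(n ⊗ 1) a], a linear map is known from its values on the
    [n ⊗ 1]; this replaces most calculations with the quotient. *)
Lemma ext_unit_epi (N : RightModule B) (M : RightModule A)
    (f f' : Hom (tens_over_ob N P) M) :
  is_module_morphism (X := tens_over N P) (Y := M) f ->
  is_module_morphism (X := tens_over N P) (Y := M) f' ->
  f ∘ ext_unit N = f' ∘ ext_unit N -> f = f'.
Proof.
move=> Lf Lf' H; apply: (coequalizer_epi (tens_over_coequalizer N P)).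
rewrite -ext_unit_act !comp_assoc Lf Lf' -!comp_assoc.
by rewrite !tensl_comp H.
Qed.

Section Lift.
Context {N : RightModule B} {M : RightModule A} (j : @Hom (ModCat B) N (restr M)).

Lemma ext_subproof :
  mod_act M ∘ (proj1_sig j ⊠ idm (A : V)) ∘ tens_over_pair1 N P =
  mod_act M ∘ (proj1_sig j ⊠ idm (A : V)) ∘ tens_over_pair2 N P.
Proof.
case: j => f Lf; rewrite /tens_over_pair1 /tens_over_pair2 /= -!comp_assoc.
rewrite tensl_comp Lf /= -comp_assoc htens_rl -tensl_comp (compl (mod_assoc M)).
rewrite -!comp_assoc htens_assoc (compl (htens_lr _ _)).
by rewrite -{2}[f]comp_idl htens_comp -!comp_assoc.
Qed.

(** [n ⊗ a ↦ j(n) a], the linear map that corresponds to [j] under the adjunction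
    between extension and restriction of scalars. *)
Definition ext : Hom (tens_over_ob N P) M :=
  proj1_sig (coequalizer_lift (tens_over_coequalizer N P) ext_subproof).

Lemma extE : ext ∘ tens_over_quo N P = mod_act M ∘ (proj1_sig j ⊠ idm (A : V)).
Proof. exact: (proj2_sig (coequalizer_lift _ _)). Qed.

Lemma ext_linear : is_module_morphism (X := tens_over N P) (Y := M) ext.
Proof.
apply: (coequalizer_epi (tens_over_coequalizer_tens N P A)); rewrite /=.
rewrite -!comp_assoc (tens_over_actE N P) -!comp_assoc (compl extE) tensl_comp extE.
rewrite -tensl_comp (compl (mod_assoc M)) -!comp_assoc assr_l.
by rewrite (compl (htens_lr _ _)) (compl (htens_rl _ _)).
Qed.

Lemma ext_unitE : ext ∘ ext_unit N = proj1_sig j.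
Proof.
rewrite /ext_unit !comp_assoc extE -!comp_assoc (compl (htens_lr _ _)) -htens_rl.
rewrite -comp_assoc (compl (mod_unit M)) (compl (htens_unitr _)) -comp_assoc unr'K.
by rewrite comp_idr.
Qed.

Definition ext_hom : @Hom (ModCat A) (tens_over N P) M := exist _ ext ext_linear.
End Lift.

Lemma tens_over_map_unit (N N' : RightModule B) (f : @Hom (ModCat B) N N') :
  tens_over_map_ob P f ∘ ext_unit N = ext_unit N' ∘ proj1_sig f.
Proof.
rewrite /ext_unit -!comp_assoc (compl (tens_over_mapE _ _)) -comp_assoc.
by rewrite unr'_nat (compl (htens_lr _ _)) (compl (htens_rl _ _)).
Qed.

(** * The coaction [x ↦ x ⊗ g] *)

Definition trivial_coact (X : V) : Hom X (X ⊗ C) := (idm X ⊠ g) ∘ unr' X.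

Lemma trivial_coact_nat (X Y : V) (f : Hom X Y) :
  trivial_coact Y ∘ f = (f ⊠ idm (C : V)) ∘ trivial_coact X.
Proof.
rewrite /trivial_coact -comp_assoc unr'_nat (compl (htens_rl _ _)).
by rewrite (compl (htens_lr _ _)).
Qed.

Lemma twisted_act_trivial (M : RightModule A) :
  twisted_act M ∘ (trivial_coact M ⊠ idm (A : V)) =
  (mod_act M ⊠ idm (C : V)) ∘ assl M A C ∘ (idm (M : V) ⊠ gcoact g).
Proof.
rewrite /twisted_act /trivial_coact /gcoact -!tensl_comp -!tensr_comp -!comp_assoc.
rewrite (comp_square (assr_m _ _ _)); coherence.
Qed.

Lemma gtriv_act (M : RightModule A) :
  (mod_act M ⊠ idm (C : V)) ∘ assl M A C ∘ (idm (M : V) ⊠ gtriv g) =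
  trivial_coact M ∘ mod_act M.
Proof.
rewrite trivial_coact_nat -comp_assoc; congr (_ ∘ _).
rewrite /trivial_coact /gtriv -tensr_comp (compl (assl_r _ _ _)) -comp_assoc.
coherence.
Qed.

(** Linear over [A^C] only: [(m ⊗ g) b = m g_A(b)], and [g_A(b) = b ⊗ g] says that
    [b] is coinvariant. *)
Lemma trivial_coact_linear (M : RightModule A) :
  is_module_morphism (X := restr M) (Y := restr (twisted M)) (trivial_coact M).
Proof.
rewrite /is_module_morphism /= -[RHS]comp_assoc htens_rl.
rewrite -(htens_lr (trivial_coact M)) [RHS]comp_assoc.
rewrite twisted_act_trivial -[RHS]comp_assoc tensr_comp (coinv_inclE g) -tensr_comp.
by rewrite comp_assoc -gtriv_act -!comp_assoc.
Qed.

Definition trivial_coact_hom (M : RightModule A) :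
    @Hom (ModCat B) (restr M) (restr (twisted M)) :=
  exist _ _ (trivial_coact_linear M).

Lemma Fbar_coact_unit (N : RightModule B) :
  Fbar_coact N ∘ ext_unit N = trivial_coact (tens_over_ob N P) ∘ ext_unit N.
Proof.
rewrite trivial_coact_nat /ext_unit /trivial_coact -!comp_assoc.
rewrite (compl (Fbar_coactE _)) -!comp_assoc (compl (tensr_comp _ _ _)).
rewrite coinv_unit_subproof gtriv_nat -!tensl_comp -tensr_comp -!comp_assoc.
congr (_ ∘ _); rewrite (comp_square (assl_nat _ _ _)).
rewrite -(htens_lr (idm (N : V) ⊠ alg_unit A) g) -!comp_assoc; congr (_ ∘ _).
rewrite (compl (htens_lr _ _)) -(htens_rl (unr' N)) -!comp_assoc; congr (_ ∘ _).
coherence.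
Qed.

(** The canonical map [m ⊗ a ↦ m · g_A(a)] with coefficients in a module; for
    [M = A] it is [can]. Defining it as an extension makes it linear and determines
    it by [m ⊗ 1 ↦ m ⊗ g]. *)
Definition can_map (M : RightModule A) : Hom (tens_over_ob (restr M) P) (M ⊗ C) :=
  ext (M := twisted M) (trivial_coact_hom M).

Lemma can_mapE (M : RightModule A) :
  can_map M ∘ tens_over_quo (restr M) P =
  (mod_act M ⊠ idm (C : V)) ∘ assl M A C ∘ (idm (M : V) ⊠ gcoact g).
Proof. by rewrite -twisted_act_trivial; exact: (extE (M := twisted M)). Qed.
End Extension.

(** * The canonical map with coefficients *)

Section CanonicalMap.
Context {V : BaseCategory} {E : Entwining V}.
Notation A := (entw_alg E).
Notation C := (entw_coalg E).
Context (g : Hom unit_ob C).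
Notation B := (coinv_alg g).
Notation P := (coinv_bimod g).
Notation restr := (restrict (coinv_incl_morphism g)).
Notation AA := (tens_over_ob (restr (regular_module A)) P).
Notation qA := (tens_over_quo (restr (regular_module A)) P).
Notation q M := (tens_over_quo (restr M) P).

Lemma move_left_coequalizer (M : V) :
  is_coequalizer (idm M ⊠ tens_over_pair1 (restr (regular_module A)) P)
    (idm M ⊠ tens_over_pair2 (restr (regular_module A)) P) (idm M ⊠ qA).
Proof.
exact: (@tensl_coequalizers V M _ _ _ _ _ _
  (tens_over_coequalizer (restr (regular_module A)) P)).
Qed.

Lemma move_left_subproof (M : RightModule A) :
  let h := q M ∘ (mod_act M ⊠ idm (A : V)) ∘ assl M A A in
  h ∘ (idm (M : V) ⊠ tens_over_pair1 (restr (regular_module A)) P) =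
  h ∘ (idm (M : V) ⊠ tens_over_pair2 (restr (regular_module A)) P).
Proof.
rewrite /= /tens_over_pair1 /tens_over_pair2 -!comp_assoc.
rewrite (assl_m _ A) (compl (tensl_comp _ _ _)).
have -> : mod_act M ∘ (idm (M : V) ⊠ mod_act (restr (regular_module A))) =
    mod_act (restr M) ∘ (mod_act M ⊠ idm (B : V)) ∘ assl M A B.
  rewrite /= -tensr_comp comp_assoc mod_act_mul -!comp_assoc; congr (_ ∘ _).
  by rewrite assl_r (compl (htens_lr _ _)) (compl (htens_rl _ _)).
have Hq := tens_over_quoE (restr M) P; move: (mod_act (restr M)) Hq => r Hq.
rewrite -!tensl_comp -!comp_assoc (compl Hq) -!comp_assoc.
congr (_ ∘ _).
rewrite (comp_square (assr_l _ _ _)) (compl (htens_rl _ _)).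
rewrite -tensr_comp (comp_square (assl_r _ _ _)) (compl (htens_lr _ _)).
congr (_ ∘ _); coherence.
Qed.

(** [m ⊗ (a ⊗ a') ↦ m a ⊗ a']. *)
Definition move_left (M : RightModule A) : Hom (M ⊗ AA) (tens_over_ob (restr M) P) :=
  proj1_sig (coequalizer_lift (move_left_coequalizer M) (move_left_subproof M)).

Lemma move_leftE (M : RightModule A) :
  move_left M ∘ (idm (M : V) ⊠ qA) = q M ∘ (mod_act M ⊠ idm (A : V)) ∘ assl M A A.
Proof. exact: (proj2_sig (coequalizer_lift _ _)). Qed.

Lemma move_left_assoc (M : RightModule A) :
  move_left M ∘ (mod_act M ⊠ idm AA) =
  move_left M ∘ (idm (M : V) ⊠ move_left (regular_module A)) ∘ assr M A AA.
Proof.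
apply: (coequalizer_epi (move_left_coequalizer (M ⊗ A))).
rewrite -!comp_assoc htens_lr -htens_rl (compl (move_leftE M)) -comp_assoc.
rewrite assr_r (compl (tensr_comp _ _ _)) (move_leftE (regular_module A)).
rewrite -!tensr_comp -!comp_assoc.
rewrite (compl (move_leftE M)) -!comp_assoc; congr (_ ∘ _).
rewrite assl_l (compl (tensl_comp _ _ _)) (comp_square (assl_m _ _ _)) /=.
rewrite (compl (tensl_comp _ _ _)) mod_act_mul -!tensl_comp -!comp_assoc.
do 2 congr (_ ∘ _); coherence.
Qed.

Lemma can_map_move_left (M : RightModule A) :
  can_map g M ∘ move_left M =
  (mod_act M ⊠ idm (C : V)) ∘ assl M A C ∘
    (idm (M : V) ⊠ can_map g (regular_module A)).
Proof.
apply: (coequalizer_epi (move_left_coequalizer M)).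
rewrite -!comp_assoc tensr_comp (can_mapE g (regular_module A)) move_leftE -comp_assoc.
rewrite (compl (can_mapE g M)) -!comp_assoc (compl (htens_rl _ _)).
move: (gcoact g) => c.
rewrite -(htens_lr (mod_act M) c) -!comp_assoc (comp_square (assl_l _ _ _)).
rewrite -!tensr_comp /= (comp_square (assl_m _ _ _)) !(compl (tensl_comp _ _ _)).
rewrite mod_act_mul -!tensl_comp -!comp_assoc; do 2 congr (_ ∘ _).
rewrite -(htens_id M A).
have -> : (idm (M : V) ⊠ idm (A : V)) ⊠ c =
    assl M A (A ⊗ C) ∘ (idm (M : V) ⊠ (idm (A : V) ⊠ c)) ∘ assr M A A.
  by rewrite -comp_assoc -htens_assoc comp_assoc assrK comp_idl.
coherence.
Qed.

(** The inverse for a general [M] comes from the inverse [k] for [A]. *)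
Section Inverse.
Context (k : Hom (A ⊗ C) AA).
Context (Hl : k ∘ can_map g (regular_module A) = idm AA).
Context (Hr : can_map g (regular_module A) ∘ k = idm (A ⊗ C)).

(** [m ⊗ c ↦ m · k(1 ⊗ c)]. *)
Definition can_map_inv (M : RightModule A) : Hom (M ⊗ C) (tens_over_ob (restr M) P) :=
  move_left M ∘ (idm (M : V) ⊠ (k ∘ (alg_unit A ⊠ idm (C : V)) ∘ unl' C)).

Lemma can_map_invK (M : RightModule A) : can_map g M ∘ can_map_inv M = idm (M ⊗ C).
Proof.
rewrite /can_map_inv comp_assoc can_map_move_left -!comp_assoc tensr_comp.
rewrite (comp_assoc _ k) Hr comp_idl -tensr_comp (compl (assl_m _ _ _)) -comp_assoc.
by rewrite (compl (tensl_comp _ _ _)) mod_unit; coherence.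
Qed.

Lemma can_map_inv_regular : can_map_inv (regular_module A) = k.
Proof.
rewrite -[LHS]comp_idl -[in LHS]Hl -comp_assoc.
by rewrite (can_map_invK (regular_module A)) comp_idr.
Qed.

Lemma can_map_inv_gcoact :
  k ∘ gcoact g = qA ∘ (alg_unit A ⊠ idm (A : V)) ∘ unl' A.
Proof.
have H : can_map g (regular_module A) ∘ (qA ∘ (alg_unit A ⊠ idm (A : V)) ∘ unl' A) =
    gcoact g.
  rewrite !comp_assoc can_mapE -!comp_assoc (compl (htens_rl _ _)).
  rewrite -(htens_lr (alg_unit A) (gcoact g)) -!comp_assoc (compl (assl_l _ _ _)).
  by rewrite -comp_assoc (compl (tensl_comp _ _ _)) /= alg_unitl -unl'_nat; coherence.
by rewrite -H (comp_assoc k) Hl comp_idl.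
Qed.

(** On [m ⊗ a] this says [m · k(g_A(a)) = m ⊗ a]. By associativity of [move_left] the
    factor [m] can be pulled out, which reduces the claim to [k] being the inverse
    of the canonical map of [A]. *)
Lemma can_mapK (M : RightModule A) : can_map_inv M ∘ can_map g M = idm _.
Proof.
apply: (coequalizer_epi (tens_over_coequalizer (restr M) P)).
rewrite comp_idl -comp_assoc can_mapE.
have -> : can_map_inv M ∘ ((mod_act M ⊠ idm (C : V)) ∘ assl M A C ∘
      (idm (M : V) ⊠ gcoact g)) =
    move_left M ∘ (idm (M : V) ⊠ (can_map_inv (regular_module A) ∘ gcoact g)).
  rewrite {1}/can_map_inv -!comp_assoc (compl (htens_rl _ _)) -htens_lr.
  rewrite -!comp_assoc (compl (move_left_assoc M)) -!comp_assoc.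
  rewrite (comp_square (assr_r _ _ _)) (compl (tensr_comp _ _ _)).
  rewrite (compl (asslK _ _ _)) comp_idl tensr_comp.
  by rewrite /can_map_inv -!comp_assoc.
rewrite can_map_inv_regular can_map_inv_gcoact -!comp_assoc -tensr_comp.
rewrite (compl (move_leftE M)) -!comp_assoc -[RHS]comp_idr; congr (_ ∘ _).
rewrite -tensr_comp (comp_square (assl_m _ _ _)) (compl (tensl_comp _ _ _)) mod_unit.
coherence.
Qed.
End Inverse.

Lemma can_map_iso (M : RightModule A) :
  is_iso (can_map g (regular_module A)) -> is_iso (can_map g M).
Proof.
move=> [k [Hl Hr]]; exists (can_map_inv k M); split.
- exact: can_mapK.
- exact: can_map_invK.
Qed.

(** [A] as a right [A^C]-module occurs both as [coinv_rmod g] and as the restriction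
    of the regular module; these have the same action. *)
Definition coinv_rmod_hom :
    @Hom (ModCat B) (coinv_rmod g) (restr (regular_module A)).
Proof.
exists (idm (A : V)).
by rewrite /is_module_morphism htens_id comp_idl comp_idr.
Defined.

Lemma coinv_rmod_hom_iso : is_iso coinv_rmod_hom.
Proof. by apply: module_iso; exists (idm (A : V)); rewrite comp_idl. Qed.

Lemma can_factor :
  can_map g (regular_module A) ∘ tens_over_map_ob P coinv_rmod_hom = can g.
Proof.
apply: (coequalizer_epi (tens_over_coequalizer (coinv_rmod g) P)).
rewrite -comp_assoc tens_over_mapE canE /can_pre /= htens_id comp_idr.
exact: (can_mapE g (regular_module A)).
Qed.

Lemma galois_can_map_iso (M : RightModule A) : is_galois g -> is_iso (can_map g M).
Proof.
move=> HG; apply: can_map_iso.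
apply: (@iso_left_factor _ _ _ _ _ (tens_over_map_ob P coinv_rmod_hom)).
- exact: (module_iso_underlying (fmap_iso (tens_over_functor P) coinv_rmod_hom_iso)).
- by rewrite can_factor.
Qed.
End CanonicalMap.

(** * The adjunction between [Fbar] and coinvariants *)

Section Coinvariants.
Context {V : BaseCategory} {E : Entwining V}.
Notation A := (entw_alg E).
Notation C := (entw_coalg E).
Context {g : Hom unit_ob C} (Hg : is_grouplike g).
Notation B := (coinv_alg g).
Notation P := (coinv_bimod g).
Notation restr := (restrict (coinv_incl_morphism g)).

Definition restr_hom (M M' : RightModule A) (f : @Hom (ModCat A) M M') :
    @Hom (ModCat B) (restr M) (restr M') :=
  exist _ _ (restrict_morphism (coinv_incl_morphism g) (proj2_sig f)).

Section Object.
Context (X : EntwinedModule E).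

Definition coinvariants_sig :
  {K : V & {e : Hom K X | is_equalizer (emod_coact X) (trivial_coact g X) e}}.
Proof.
case: (constructive_indefinite_description _
  (has_equalizers (emod_coact X) (trivial_coact g X))) => K HK.
by exists K; apply: constructive_indefinite_description.
Qed.

Definition coinvariants_ob : V := projT1 coinvariants_sig.

Definition coinvariants_incl : Hom coinvariants_ob X :=
  proj1_sig (projT2 coinvariants_sig).

Lemma coinvariants_equalizer :
  is_equalizer (emod_coact X) (trivial_coact g X) coinvariants_incl.
Proof. exact: (proj2_sig (projT2 coinvariants_sig)). Qed.

Definition coinvariants : RightModule B :=
  equalizer_module (f := restr_hom (emod_coact_hom X)) (h := trivial_coact_hom g X)
    coinvariants_equalizer.

Definition coinvariants_hom : @Hom (ModCat B) coinvariants (restr X) :=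
  equalizer_module_incl (f := restr_hom (emod_coact_hom X))
    (h := trivial_coact_hom g X) coinvariants_equalizer.

Lemma coinvariants_hom_equalizer :
  is_equalizer (restr_hom (emod_coact_hom X)) (trivial_coact_hom g X) coinvariants_hom.
Proof. exact: equalizer_module_equalizer. Qed.

(** Both sides of the colinearity square are linear maps to [X ⊗ C], so it suffices
    to compare them on the [n ⊗ 1], which are coinvariant in the image of [Fbar]. *)
Lemma ext_colinear (N : RightModule B) (j : @Hom (ModCat B) N (restr X)) :
  emod_coact X ∘ proj1_sig j = trivial_coact g X ∘ proj1_sig j ->
  is_comodule_morphism (Fbar_coact N) (emod_coact X) (ext j).
Proof.
move=> Hj; rewrite /is_comodule_morphism.
apply: (ext_unit_epi (M := twisted X)).
- exact: (module_morphism_comp (ext_linear j) (emod_coact_linear X)).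
- exact: (cofree_transpose_linear (X := Fbar_ob Hg N) (ext_linear j)).
- rewrite -!comp_assoc ext_unitE Hj Fbar_coact_unit comp_assoc -trivial_coact_nat.
  by rewrite -[RHS]comp_assoc ext_unitE.
Qed.

(** [x ⊗ a ↦ x a] for coinvariant [x]. *)
Definition adj_counit :
    @Hom (EntwinedCat E) (Fbar_ob Hg coinvariants) X :=
  exist _ _ (conj (ext_linear coinvariants_hom)
                  (ext_colinear (j := coinvariants_hom) (proj1 coinvariants_equalizer))).
End Object.

Lemma coinvariants_map_subproof (X Y : EntwinedModule E)
    (f : @Hom (EntwinedCat E) X Y) :
  restr_hom (emod_coact_hom Y) ∘
    (restr_hom (fmap (emod_forget E) f) ∘ coinvariants_hom X) =
  trivial_coact_hom g Y ∘
    (restr_hom (fmap (emod_forget E) f) ∘ coinvariants_hom X).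
Proof.
case: f => f [Lf Cf]; apply: sig_ext.
change (emod_coact Y ∘ (f ∘ coinvariants_incl X) =
  trivial_coact g Y ∘ (f ∘ coinvariants_incl X)).
rewrite (comp_assoc (emod_coact Y)) Cf (comp_assoc (trivial_coact g Y)).
rewrite trivial_coact_nat -[LHS]comp_assoc -[RHS]comp_assoc.
by rewrite (proj1 (coinvariants_equalizer X)).
Qed.

Definition coinvariants_map (X Y : EntwinedModule E) (f : @Hom (EntwinedCat E) X Y) :
    @Hom (ModCat B) (coinvariants X) (coinvariants Y) :=
  proj1_sig (equalizer_lift (coinvariants_hom_equalizer Y) (coinvariants_map_subproof f)).

Lemma coinvariants_mapE (X Y : EntwinedModule E) (f : @Hom (EntwinedCat E) X Y) :
  coinvariants_hom Y ∘ coinvariants_map f =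
  restr_hom (fmap (emod_forget E) f) ∘ coinvariants_hom X.
Proof. exact: (proj2_sig (equalizer_lift _ _)). Qed.

Definition coinvariants_functor : Functor (EntwinedCat E) (ModCat B).
Proof.
refine {| fobj := coinvariants : EntwinedCat E -> ModCat B;
          fmap := coinvariants_map |}.
- move=> X; apply: (equalizer_mono (coinvariants_hom_equalizer X)).
  rewrite coinvariants_mapE fmap_id comp_idr.
  by apply: sig_ext; rewrite /= comp_idl.
- move=> X Y Z f h; apply: (equalizer_mono (coinvariants_hom_equalizer Z)).
  rewrite comp_assoc !coinvariants_mapE -comp_assoc coinvariants_mapE comp_assoc.
  by congr (_ ∘ _); apply: sig_ext.
Defined.

Lemma adj_unit_subproof (N : RightModule B) :
  restr_hom (emod_coact_hom (Fbar_ob Hg N)) ∘ ext_unit_hom N =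
  trivial_coact_hom g (tens_over N P) ∘ ext_unit_hom N.
Proof. by apply: sig_ext; exact: Fbar_coact_unit. Qed.

Definition adj_unit (N : RightModule B) :
    @Hom (ModCat B) N (coinvariants (Fbar_ob Hg N)) :=
  proj1_sig (equalizer_lift (coinvariants_hom_equalizer (Fbar_ob Hg N))
               (adj_unit_subproof N)).

Lemma adj_unitE (N : RightModule B) :
  coinvariants_hom (Fbar_ob Hg N) ∘ adj_unit N = ext_unit_hom N.
Proof. exact: (proj2_sig (equalizer_lift _ _)). Qed.

Lemma adj_unit_nat (N N' : RightModule B) (f : @Hom (ModCat B) N N') :
  adj_unit N' ∘ f = coinvariants_map (fmap (Fbar Hg) f) ∘ adj_unit N.
Proof.
apply: (equalizer_mono (coinvariants_hom_equalizer (Fbar_ob Hg N'))).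
rewrite comp_assoc adj_unitE comp_assoc coinvariants_mapE -comp_assoc adj_unitE.
by apply: sig_ext; rewrite /= tens_over_map_unit.
Qed.

Lemma adj_counit_nat (X Y : EntwinedModule E) (f : @Hom (EntwinedCat E) X Y) :
  adj_counit Y ∘ fmap (Fbar Hg) (coinvariants_map f) = f ∘ adj_counit X.
Proof.
apply: sig_ext; apply: (ext_unit_epi (M := Y)).
- exact: (proj1 (proj2_sig (adj_counit Y ∘ fmap (Fbar Hg) (coinvariants_map f)))).
- exact: (proj1 (proj2_sig (f ∘ adj_counit X))).
- change (ext (coinvariants_hom Y) ∘ tens_over_map_ob P (coinvariants_map f) ∘
      ext_unit (coinvariants X) =
    proj1_sig f ∘ ext (coinvariants_hom X) ∘ ext_unit (coinvariants X)).
  rewrite -!comp_assoc (tens_over_map_unit (coinvariants_map f)) comp_assoc !ext_unitE.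
  exact: (f_equal (@proj1_sig _ _) (coinvariants_mapE f)).
Qed.

Lemma adj_triangle (N : RightModule B) :
  adj_counit (Fbar_ob Hg N) ∘ fmap (Fbar Hg) (adj_unit N) = idm (Fbar Hg N).
Proof.
apply: sig_ext; apply: (ext_unit_epi (M := tens_over N P)).
- exact: (proj1 (proj2_sig
    (adj_counit (Fbar_ob Hg N) ∘ fmap (Fbar Hg) (adj_unit N)))).
- exact: (proj1 (proj2_sig (idm (Fbar Hg N)))).
- change (ext (coinvariants_hom (Fbar_ob Hg N)) ∘ tens_over_map_ob P (adj_unit N) ∘
      ext_unit N = idm (tens_over_ob N P) ∘ ext_unit N).
  rewrite -!comp_assoc (tens_over_map_unit (adj_unit N)) comp_assoc ext_unitE comp_idl.
  exact: (f_equal (@proj1_sig _ _) (adj_unitE N)).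
Qed.

Lemma equivalence_of_units :
  (forall X : EntwinedModule E, is_iso (adj_counit X)) ->
  (forall N : RightModule B, is_iso (adj_unit N)) ->
  is_equivalence (Fbar Hg).
Proof.
move=> Hc Hu; exists coinvariants_functor; split.
- apply: naturally_isomorphic_sym; exists adj_unit; split=> // N N' f.
  exact: adj_unit_nat.
- by exists adj_counit; split=> // X Y f; exact: adj_counit_nat.
Qed.

(** * Galois and faithfully flat implies equivalence *)

(** Tensoring the equalizer that defines the coinvariants with [A] turns it, along
    the canonical maps, into the split equalizer of [emod_coact_equalizer]. *)
Lemma adj_counit_iso (X : EntwinedModule E) :
  is_galois g -> left_flat P -> is_iso (adj_counit X).
Proof.
move=> HG HF; apply: emod_iso.
suff : is_iso (ext_hom (coinvariants_hom X)) by exact: module_iso_underlying.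
have H1 := HF _ _ _ _ _ _ (coinvariants_hom_equalizer X).
have H2 := emod_coact_equalizer X.
have canI M := galois_can_map_iso M HG.
pose ch (M : RightModule A) := ext_hom (M := twisted M) (trivial_coact_hom g M).
have chI M : is_iso (ch M) by apply: module_iso; exact: canI.
have hom_ext (N : RightModule B) (M : RightModule A)
    (f f' : @Hom (ModCat A) (tens_over N P) M) :
  proj1_sig f ∘ ext_unit N = proj1_sig f' ∘ ext_unit N -> f = f'.
  move=> H; apply: sig_ext; apply: (ext_unit_epi (M := M)) H; exact: proj2_sig.
have chU M : can_map g M ∘ ext_unit (restr M) = trivial_coact g M.
  exact: (ext_unitE (M := twisted M)).
have K1 := @equalizer_comparison_iso (ModCat A) _ _ _ _ _ _ _ _ _ _ _ _
  (ch X) (ch (twisted X)) (ext_hom (coinvariants_hom X)) H1 H2.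
apply: (K1 (chI X)).
- by move=> Z v w; exact: iso_mono (chI _).
- apply: hom_ext.
  change (can_map g (twisted X) ∘ tens_over_map_ob P (restr_hom (emod_coact_hom X)) ∘
     ext_unit (restr X) =
     (emod_coact X ⊠ idm (C : V)) ∘ can_map g X ∘ ext_unit (restr X)).
  rewrite -!comp_assoc tens_over_map_unit chU comp_assoc (chU (twisted X)).
  exact: trivial_coact_nat.
- apply: hom_ext.
  change (can_map g (twisted X) ∘ tens_over_map_ob P (trivial_coact_hom g X) ∘
     ext_unit (restr X) =
     cofree_coact X ∘ can_map g X ∘ ext_unit (restr X)).
  rewrite -!comp_assoc tens_over_map_unit chU comp_assoc (chU (twisted X)) /=.
  rewrite /cofree_coact trivial_coact_nat /trivial_coact.
  rewrite (compl (tensr_comp _ _ _)) (proj2 Hg) -tensl_comp -tensr_comp -!comp_assoc.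
  rewrite (comp_square (assl_nat _ _ _)) (compl (htens_lr _ _)).
  rewrite -(htens_rl (unr' (X : V))) -!comp_assoc (compl (htens_lr _ _)).
  by congr (_ ∘ _); coherence.
- apply: hom_ext.
  change (emod_coact X ∘ ext (coinvariants_hom X) ∘ ext_unit (coinvariants X) =
     can_map g X ∘ tens_over_map_ob P (coinvariants_hom X) ∘
     ext_unit (coinvariants X)).
  rewrite -!comp_assoc ext_unitE tens_over_map_unit comp_assoc chU.
  exact: (proj1 (coinvariants_equalizer X)).
Qed.

(** The triangle identity makes the image of the unit a section of an isomorphism,
    so the unit is invertible by conservativity. *)
Lemma galois_faithfully_flat_equivalence :
  is_galois g -> left_faithfully_flat P -> is_equivalence (Fbar Hg).
Proof.
move=> HG [HF HC]; have Hc X := adj_counit_iso X HG HF.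
apply: equivalence_of_units => // N; apply: HC.
have HN : is_iso (fmap (Fbar Hg) (adj_unit N)).
  exact: iso_cancel_section (Hc _) (adj_triangle N).
by apply: module_iso; exact: (emod_iso_underlying HN).
Qed.

(** * Equivalence implies Galois and faithfully flat *)

Lemma equivalence_faithfully_flat :
  flat_object (C : V) -> is_equivalence (Fbar Hg) -> left_faithfully_flat P.
Proof.
move=> HC HF; split.
- move=> K N N' f h e He.
  have H := emod_forget_preserves_equalizers HC
    (equivalence_preserves_equalizers HF He).
  have forget_Fbar (N1 N2 : RightModule B) (k : @Hom (ModCat B) N1 N2) :
      fmap (emod_forget E) (fmap (Fbar Hg) k) =
      fmap (tens_over_functor P) k :> @Hom (ModCat A) (tens_over N1 P) (tens_over N2 P).
    exact: sig_ext.
  change (@is_equalizer (ModCat A) (tens_over K P) (tens_over N P) (tens_over N' P)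
    (fmap (emod_forget E) (fmap (Fbar Hg) f)) (fmap (emod_forget E) (fmap (Fbar Hg) h))
    (fmap (emod_forget E) (fmap (Fbar Hg) e))) in H.
  by rewrite !forget_Fbar in H.
- move=> N N' f Hf; apply: (equivalence_conservative HF); apply: emod_iso.
  exact: (module_iso_underlying Hf).
Qed.

Lemma can_transpose :
  can g = cofree_transpose (X := Fbar_ob Hg (coinv_rmod g)) (ext (coinv_rmod_hom g)).
Proof.
apply: (coequalizer_epi (tens_over_coequalizer (coinv_rmod g) P)).
rewrite canE /cofree_transpose -[RHS]comp_assoc (Fbar_coactE (coinv_rmod g)) -!comp_assoc.
rewrite (compl (tensl_comp _ _ _)) (extE (coinv_rmod_hom g)) /= htens_id comp_idr.
by rewrite /can_pre -comp_assoc.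
Qed.

Definition can_hom :
  @Hom (EntwinedCat E) (Fbar_ob Hg (coinv_rmod g)) (cofree (regular_module A)).
Proof.
exists (can g); rewrite can_transpose; split.
- exact: (cofree_transpose_linear (X := Fbar_ob Hg (coinv_rmod g)) (ext_linear _)).
- exact: cofree_transpose_colinear.
Defined.

Lemma can_counit_unit :
  cofree_counit (regular_module A) ∘ can g ∘ ext_unit (coinv_rmod g) = idm (A : V).
Proof.
rewrite can_transpose (cofree_transposeK (X := Fbar_ob Hg (coinv_rmod g))).
exact: (ext_unitE (coinv_rmod_hom g)).
Qed.

(** Maps in entwined modules from the image of [N] to the cofree [A ⊗ C] correspond
    to linear maps [N ⊗ A -> A] over [A], hence to linear maps [N -> A] over [A^C];
    this is how [h] is recovered from its image under composition with [can]. *)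
Lemma can_recovers (N : RightModule B) (h : @Hom (ModCat B) N (coinv_rmod g)) :
  cofree_counit (regular_module A) ∘ proj1_sig (can_hom ∘ fmap (Fbar Hg) h) ∘
    ext_unit N = proj1_sig h.
Proof.
change (cofree_counit (regular_module A) ∘ (can g ∘ tens_over_map_ob P h) ∘
  ext_unit N = proj1_sig h).
rewrite -[RHS]comp_idl -can_counit_unit -[RHS]comp_assoc -(tens_over_map_unit h).
by rewrite [RHS]comp_assoc; congr (_ ∘ _); exact: comp_assoc.
Qed.

Lemma Fbar_cofree_ext (N : RightModule B) (M : RightModule A)
    (p p' : @Hom (EntwinedCat E) (Fbar_ob Hg N) (cofree M)) :
  cofree_counit M ∘ proj1_sig p ∘ ext_unit N =
    cofree_counit M ∘ proj1_sig p' ∘ ext_unit N -> p = p'.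
Proof.
move=> H; apply: cofree_ext.
exact: (ext_unit_epi (M := M) (cofree_counit_comp_linear p)
  (cofree_counit_comp_linear p') H).
Qed.

Lemma can_lift_linear (N : RightModule B)
    (p : @Hom (EntwinedCat E) (Fbar_ob Hg N) (cofree (regular_module A))) :
  is_module_morphism (X := N) (Y := coinv_rmod g)
    (cofree_counit (regular_module A) ∘ proj1_sig p ∘ ext_unit N).
Proof.
have Lt := restrict_morphism (coinv_incl_morphism g) (cofree_counit_comp_linear p).
exact: (module_morphism_comp (ext_unit_linear N) Lt).
Qed.

Definition can_lift (N : RightModule B)
    (p : @Hom (EntwinedCat E) (Fbar_ob Hg N) (cofree (regular_module A))) :
    @Hom (ModCat B) N (coinv_rmod g) :=
  exist _ _ (can_lift_linear p).

Lemma can_liftE (N : RightModule B)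
    (p : @Hom (EntwinedCat E) (Fbar_ob Hg N) (cofree (regular_module A))) :
  can_hom ∘ fmap (Fbar Hg) (can_lift p) = p.
Proof. by apply: Fbar_cofree_ext; rewrite can_recovers. Qed.

Lemma equivalence_galois : is_equivalence (Fbar Hg) -> is_galois g.
Proof.
move=> HF; suff H : is_iso can_hom by exact: (emod_iso_underlying H).
apply: (representing_iso (F := Fbar Hg)).
- exact: equivalence_full.
- exact: equivalence_essentially_surjective.
- by move=> N p; exists (can_lift p); exact: can_liftE.
- move=> N h h' H; apply: sig_ext.
  by rewrite -(can_recovers h) -(can_recovers h') H.
Qed.
End Coinvariants.

Theorem theorem5p6 (V : BaseCategory) (E : Entwining V)
    (g : Hom unit_ob (entw_coalg E)) (Hg : is_grouplike g) :
  flat_object (entw_coalg E : V) ->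
  (is_equivalence (Fbar Hg) <->
   is_galois g /\ left_faithfully_flat (coinv_bimod g)).
Proof.
move=> HC; split.
- by move=> HF; split; [exact: equivalence_galois | exact: equivalence_faithfully_flat].
- by move=> [HG HF]; exact: galois_faithfully_flat_equivalence.
Qed.
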